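(* Let $N$ be a point process in $\mathbb{R}^d$ with locally finite intensity measure $\nu$, i.e. $\nu(K)=\mathbb{E}[N(K)]<\infty$ for every compact set $K\subset\mathbb{R}^d$. Let $p\in[0,1]$, let $N_1$ be the homogeneous independent thinning of $N$ with acceptance probability $p$, and let $N_2 = N-N_1$ be the complementary process (the thinning with acceptance probability $1-p$). Then $N$ is a Poisson process if and only if $N_1$ and $N_2$ are independent.
   Context: A point process $N$ in $\mathbb{R}^d$ is a random locally finite integer-valued counting measure; $N(K)$ denotes the number of points in $K$. No stationarity is assumed. Homogeneous independent thinning: conditionally on $N$, each point of $N$ is assigned to $N_1$ with probability $p$ and to $N_2$ with probability $1-p$, independently over points, so that $N=N_1+N_2$. In particular, for every compact set $K$ and all integers $i,j\ge 0$, $$\mathbb{P}(N_1(K)=i,\,N_2(K)=j)=\mathbb{P}(N(K)=i+j)\binom{i+j}{i}p^i(1-p)^j$$ (with $0^0=1$). A Poisson process (possibly non-homogeneous) with locally finite intensity measure $\nu$ is a point process $N$ such that $N(B)$ is Poisson distributed with mean $\nu(B)$ for every bounded Borel set $B$ (a Poisson variable with mean $0$ being identically $0$), and the counts on pairwise disjoint bounded Borel sets are independent.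
   Formalization: The implication ''N_1 and N_2 independent implies N Poisson'' is stated only for 0 < p < 1, since it fails at p = 0 and p = 1 (e.g. N one deterministic point); ''N Poisson implies independence'' is kept for all p in [0,1]. *)

(* Defs.v *)
From HB Require Import structures.
From mathcomp Require Import all_boot all_order all_algebra.
From mathcomp Require Import all_classical all_reals all_analysis.
From mathcomp Require Import measurable_realfun.

Set Implicit Arguments.
Unset Strict Implicit.
Unset Printing Implicit Defensive.

Import Order.TTheory GRing.Theory Num.Theory.
Import numFieldNormedType.Exports.

Local Open Scope classical_set_scope.
Local Open Scope ring_scope.
Local Open Scope ereal_scope.

(* The norm of 'rV[R]_d is the sup norm; it has the same open, compact and
   bounded sets as the Euclidean norm. *)
Notation borelRd R d := (g_sigma_algebraType (@open 'rV[R]_d)).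

Section point_processes.
Context (R : realType) (d : nat) (dO : measure_display)
  (Omega : measurableType dO) (P : probability Omega R).
Implicit Types (N M : R.-ker Omega ~> borelRd R d).
Implicit Types (mu : set (borelRd R d) -> \bar R).

(* A random measure is a kernel from Omega to R^d: every N ^~ B with B Borel
   is measurable. *)
Definition point_process N : Prop :=
  forall w (B : set 'rV[R]_d), measurable (B : set (borelRd R d)) ->
    bounded_set B -> exists n : nat, N w B = n%:R%:E.

Definition intensity N (B : set (borelRd R d)) : \bar R := \int[P]_w N w B.

Definition locally_finite mu : Prop :=
  forall K : set 'rV[R]_d, compact K -> mu K < +oo.

Definition mutually_independent d' (T : measurableType d') (n : nat)
    (Y : 'I_n -> Omega -> T) : Prop :=
  forall E : 'I_n -> set T, (forall i, measurable (E i)) ->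
    P (\bigcap_(i in [set: 'I_n]) (Y i @^-1` E i)) =
    \prod_(i < n) P (Y i @^-1` E i).

(* The last argument 0 of poisson_prob is a dummy. For rate 0, poisson_prob is
   the Dirac mass at 0, whereas poisson_pmf would be constantly 1. *)
Definition poisson_process_with N (mu : {measure set (borelRd R d) -> \bar R}) :
    Prop :=
  [/\ point_process N,
      (forall B : set 'rV[R]_d, measurable (B : set (borelRd R d)) ->
        bounded_set B -> forall k : nat,
        P [set w | N w B = k%:R%:E] = poisson_prob (fine (mu B)) 0 [set k]) &
      (forall (n : nat) (B : 'I_n -> set 'rV[R]_d),
        (forall i, measurable (B i : set (borelRd R d))) ->
        (forall i, bounded_set (B i)) ->
        trivIset setT B ->
        mutually_independent (fun i w => N w (B i)))].

Definition poisson_process N : Prop :=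
  exists mu : {measure set (borelRd R d) -> \bar R},
    locally_finite mu /\ poisson_process_with N mu.

Definition count_events N : set (set Omega) :=
  \bigcup_(B in measurable) preimage_set_system setT (N ^~ B) measurable.

Definition independent_processes N M : Prop :=
  forall E F, <<s count_events N >> E -> <<s count_events M >> F ->
    P (E `&` F) = P E * P F.

(* N is the sum of the Dirac masses at the points X i w with i < N w setT,
   repeated according to multiplicity; the values X i w with i >= N w setT are
   irrelevant. *)
Definition enumerates N (X : nat -> Omega -> borelRd R d) : Prop :=
  (forall i, measurable_fun setT (X i)) /\
  forall w B, measurable B ->
    N w B = \sum_(0 <= i <oo | i%:R%:E < N w setT) \d_(X i w) B.

(* Given N and its enumerated points, the marks of the points (those with
   i < N w setT) are independent Bernoulli(p) variables. *)
Definition bernoulli_marks (p : R) N (X : nat -> Omega -> borelRd R d)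
    (U : nat -> Omega -> bool) : Prop :=
  (forall i, measurable_fun setT (U i)) /\
  forall (n : nat) (b : nat -> bool) (A : set Omega),
    <<s count_events N `|`
        \bigcup_i preimage_set_system setT (X i) measurable >> A ->
    A `<=` [set w | n%:R%:E <= N w setT] ->
    P (A `&` [set w | forall i, (i < n)%N -> U i w = b i]) =
    P A * (\prod_(i < n) bernoulli_pmf p (b i))%R%:E.

Definition thinning (p : R) N N1 : Prop :=
  exists (X : nat -> Omega -> borelRd R d) (U : nat -> Omega -> bool),
    [/\ enumerates N X, bernoulli_marks p N X U &
        forall w B, measurable B ->
          N1 w B =
          \sum_(0 <= i <oo | (i%:R%:E < N w setT) && U i w) \d_(X i w) B].

End point_processes.

(* Main.v *)
(* Thinning conditions on N: given an event D that ignores the marks of the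
   points of N in a bounded set B, and given N(B) = n, the count N1(B) is
   binomial(n, p).  This is checked on the countably many events that prescribe
   the set of indices of the points in B.

   If N is Poisson, then for disjoint bounded sets C_k the joint law of all the
   N1(C_k), N2(C_k) is, by this formula, a product of a function of the
   N1-counts and a function of the N2-counts, so both families are independent;
   the atoms of a finite family of sets reduce general sets to disjoint ones.

   Conversely, let N1 and N2 be independent, let D1 and D2 be events about N1
   and N2 outside B, and put f_D(n) = n! P(D, N(B) = n).  The formula reads
   f_(D1 & D2)(i + j) = x_D1(i) y_D2(j).  For trivial D1, D2 it gives
   f(n + m) f(0) = f(n) f(m), so N(B) is Poisson; comparing with a trivial D2 and
   with a trivial D1 gives f_D(n) f(m) = f_D(m) f(n), and summing over m makes
   N(B) independent of D1 & D2. *)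

Require Import Defs.
From HB Require Import structures.
From mathcomp Require Import all_boot all_order all_algebra.
From mathcomp Require Import all_classical all_reals all_analysis.
From mathcomp Require Import measurable_realfun.
From mathcomp Require Import ring lra.

Set Implicit Arguments.
Unset Strict Implicit.
Unset Printing Implicit Defensive.

Import Order.TTheory GRing.Theory Num.Theory.
Import numFieldNormedType.Exports.

Local Open Scope classical_set_scope.
Local Open Scope ring_scope.

(** * Factorization of probabilities over countable partitions and pi-systems *)

Section finite_probability.
Context d (T : measurableType d) (R : realType) (P : probability T R).

(** Real-valued, so that [ring], [field] and [lra] apply; [prE] returns to [P] on measurable
    sets. *)
Definition pr (A : set T) : R := fine (P A).

Lemma prE A : measurable A -> P A = (pr A)%:E.
Proof. by move=> mA; rewrite fineK// fin_num_measure. Qed.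

Lemma pr_ge0 A : 0 <= pr A.
Proof. by rewrite fine_ge0. Qed.

Lemma pr_setT : pr setT = 1.
Proof. by rewrite /pr probability_setT. Qed.

Lemma pr_set0 : pr set0 = 0.
Proof. by rewrite /pr measure0. Qed.

Lemma pr_setU A B : measurable A -> measurable B -> A `&` B = set0 ->
  pr (A `|` B) = pr A + pr B.
Proof.
move=> mA mB AB; have mU := measurableU _ _ mA mB.
by apply: EFin_inj; rewrite EFinD -!prE// measureU.
Qed.

Lemma pr_setIC A B : measurable A -> measurable B ->
  pr A = pr (A `&` B) + pr (A `&` ~` B).
Proof.
move=> mA mB; rewrite -pr_setU; first by rewrite -setIUr setUv setIT.
- exact: measurableI.
- exact/measurableI/measurableC.
- by rewrite setIACA setICr setI0.
Qed.

(** Countable additivity over the cells [F i]. The factors [a] and [b] let the same statement yield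
    equalities, product formulas (one factor is a probability) and null sets (one factor is 0). *)
Lemma pr_partition (I : countType) (F : I -> set T) (A B : set T) (a b : R) :
  (forall i, measurable (F i)) -> measurable A -> measurable B ->
  (forall i j w, F i w -> F j w -> i = j) ->
  (forall w, A w \/ B w -> exists i, F i w) ->
  (forall i, a * pr (A `&` F i) = b * pr (B `&` F i)) ->
  a * pr A = b * pr B.
Proof.
move=> mF mA mB tF cF eF.
(* The cells are renumbered by [nat] through the partial inverse of [pickle]; numbers that code no
   index get the empty cell. *)
pose G n := oapp F set0 (pickle_inv n).
have mG n : measurable (G n) by rewrite /G; case: pickle_inv => [i|] /=; [exact: mF|exact: measurable0].
have tG : trivIset setT G.
  move=> m n _ _ [w []]; rewrite /G.
  have := pickle_invK (T := I) m; have := pickle_invK (T := I) n.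
  case: pickle_inv => [j /= <-|//]; case: pickle_inv => [i /= <-|//].
  by move=> Fi Fj; rewrite (tF _ _ _ Fi Fj).
have split C : measurable C -> (forall w, C w -> exists i, F i w) ->
    P C = (\sum_(n <oo) (pr (C `&` G n))%:E)%E.
  move=> mC CF; have {1}-> : C = \bigcup_n (C `&` G n).
    apply/seteqP; split=> [w Cw|w [n _ []]//].
    have [i Fi] := CF _ Cw; exists (pickle i) => //; split=> //.
    by rewrite /G pickleK_inv.
  rewrite measure_semi_bigcup => [|n||].
  - by apply: eq_eseriesr => n _; apply: prE; exact: measurableI.
  - exact: measurableI.
  - exact: trivIset_setIl.
  - by apply: bigcup_measurable => n _; exact: measurableI.
apply: EFin_inj; rewrite !EFinM -!prE// !split//; last first.
- by move=> w Aw; apply: cF; left.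
- by move=> w Bw; apply: cF; right.
rewrite -!nneseriesZl; try by move=> n _; rewrite lee_fin pr_ge0.
apply: eq_eseriesr => n _; rewrite -!EFinM; congr EFin.
by rewrite /G; case: pickle_inv => //=; rewrite !setI0 pr_set0 !mulr0.
Qed.

(** The exchange identity says that the matrix of the [pr (V i]&[W j)] has rank one, so the two
    partitions are independent; [A] is a union of cells [V i] and [B] one of cells [W j]. In this
    form no marginal law has to be computed. *)
Lemma pr_product_partition (I J : countType) (V : I -> set T) (W : J -> set T) :
  (forall i, measurable (V i)) -> (forall j, measurable (W j)) ->
  (forall i i' w, V i w -> V i' w -> i = i') ->
  (forall j j' w, W j w -> W j' w -> j = j') ->
  (forall w, exists i, V i w) -> (forall w, exists j, W j w) ->
  (forall i i' j j', pr (V i `&` W j) * pr (V i' `&` W j') =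
                     pr (V i `&` W j') * pr (V i' `&` W j)) ->
  forall A B, measurable A -> measurable B ->
  (forall i, V i `<=` A \/ A `&` V i = set0) ->
  (forall j, W j `<=` B \/ B `&` W j = set0) ->
  pr (A `&` B) = pr A * pr B.
Proof.
move=> mV mW tV tW cV cW VW A B mA mB AV BW.
(* Sum the exchange identity over the cells of one factor at a time. *)
pose mI := @measurableI _ T.
have VWA A' j i' j' : measurable A' -> (forall i, V i `<=` A' \/ A' `&` V i = set0) ->
    pr (V i' `&` W j') * pr (A' `&` W j) = pr (V i' `&` W j) * pr (A' `&` W j').
  move=> mA' A'V; apply: (pr_partition (F := V)) => //; do ?exact: mI.
  move=> i; rewrite !(setIAC _ _ (V i)).
  have [/setIidr -> | ->] := A'V i; last by rewrite !set0I pr_set0 !mulr0.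
  by rewrite mulrC VW mulrC.
have WA j j' : pr (A `&` W j) * pr (W j') = pr (A `&` W j') * pr (W j).
  apply: (pr_partition (F := V)) => //.
  by move=> i; rewrite ![W _ `&` V _]setIC mulrC VWA// mulrC.
have WAB j' : pr (W j') * pr (A `&` B) = pr (A `&` W j') * pr B.
  apply: (pr_partition (F := W)) => //; do ?exact: mI.
  move=> j; rewrite -setIA.
  have [/setIidr -> | ->] := BW j; last by rewrite !setI0 pr_set0 !mulr0.
  by rewrite mulrC WA.
rewrite -[LHS]mulr1 -pr_setT [RHS]mulrC.
apply: (pr_partition (F := W)) => //.
by move=> j; rewrite setTI mulrC WAB mulrC.
Qed.

(** Dynkin's pi-lambda argument: for fixed [B] the factorization survives complements and disjoint
    countable unions. *)
Lemma pr_independent_g_sigma (G : set (set T)) (B : set T) :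
  G `<=` measurable -> setI_closed G -> measurable B ->
  (forall A, G A -> pr (A `&` B) = pr A * pr B) ->
  forall A, <<s G >> A -> pr (A `&` B) = pr A * pr B.
Proof.
move=> GM GI mB GB.
have sGM : <<s G >> `<=` measurable.
  by apply: smallest_sub => //; exact: sigma_algebra_measurable.
pose ok A := pr (A `&` B) = pr A * pr B.
have okC A : <<s G >> A -> ok A -> ok (~` A).
  move=> /sGM mA; rewrite /ok => okA; have := pr_setIC mB mA.
  have := pr_setIC (@measurableT _ T) mA; rewrite !setTI pr_setT.
  rewrite !(setIC B) okA => A1 BA; have -> : pr (~` A) = 1 - pr A by lra.
  by rewrite mulrBl mul1r; lra.
have okU (F : nat -> set T) : (forall n, <<s G >> (F n)) ->
    trivIset setT F -> (forall n, ok (F n)) -> ok (\bigcup_k F k).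
  move=> oF tF okF; rewrite /ok -[LHS]mul1r [RHS]mulrC.
  have mF k : measurable (F k) by exact: sGM.
  have mU : measurable (\bigcup_k F k) by exact: bigcup_measurable.
  apply: (pr_partition (F := F)) => //; first exact: measurableI.
  - by move=> i j w Fi Fj; apply: tF => //; exists w.
  - by move=> w [[[k _ Fk] _]|[k _ Fk]]; exists k.
  move=> k; have /setIidr FU : F k `<=` \bigcup_k F k by move=> w Fk; exists k.
  by rewrite mul1r setIAC FU mulrC okF.
apply: (@dynkin_induction _ (g_sigma_algebraType G) G ok) => //.
by rewrite /ok setTI pr_setT mul1r.
Qed.

End finite_probability.

(** * Integer counts as extended reals, and series of indicators *)

Lemma natr_EFin_inj (R : realType) (m n : nat) :
  m%:R%:E = n%:R%:E :> \bar R -> m = n.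
Proof. by move=> [/eqP]; rewrite eqr_nat => /eqP. Qed.

Lemma natr_EFin_addI (R : realType) (m n : nat) (x : \bar R) :
  ((m + n)%:R%:E = m%:R%:E + x)%E -> x = n%:R%:E.
Proof. by case: x => [r||] //; rewrite -EFinD natrD => -[/addrI ->]. Qed.

Section indicator_series.
Context (R : realType).
Implicit Types (c : pred nat) (S : seq nat).

Lemma eseries_indic c S : uniq S -> (forall i, c i = (i \in S)) ->
  (\sum_(0 <= i <oo) (c i)%:R%:E = (size S)%:R%:E :> \bar R)%E.
Proof.
move=> uS cS; pose M := (\max_(i <- S) i).+1.
rewrite (nneseries_split _ M)// add0n [X in (_ + X)%E]eseries0; last first.
  move=> i Mi _; rewrite cS; case: (boolP (i \in S)) => // iS.
  by move: Mi; rewrite ltnNge (leq_bigmax_seq (F := id)).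
rewrite adde0 sumEFin -natr_sum; congr (_%:R%:E).
transitivity (count c (index_iota 0 M)).
  by rewrite -sum1_count [RHS]big_mkcond; apply: eq_bigr => i _; case: (c i).
rewrite -size_filter; apply: perm_size; apply: uniq_perm => //.
  exact/filter_uniq/iota_uniq.
move=> i; rewrite mem_filter mem_index_iota /=.
rewrite cS; case: (boolP (i \in S)) => //= iS.
by rewrite ltnS (leq_bigmax_seq (F := id)).
Qed.

(** The partial counts are bounded by [n], so their maximum is reached at some [m], and an index
    satisfying [c] from [m] on would exceed it. Sortedness makes the list unique, so that lists can
    label disjoint events. *)
Lemma eseries_indic_fin c (n : nat) :
  (\sum_(0 <= i <oo) (c i)%:R%:E = n%:R%:E :> \bar R)%E ->
  exists2 S, sorted ltn S & forall i, c i = (i \in S).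
Proof.
move=> cn; pose cnt m := count c (iota 0 m).
have cntn m : (cnt m <= n)%N.
  rewrite -(ler_nat R) -lee_fin -cn.
  apply: le_trans (nneseries_lim_ge m _) => //.
  rewrite sumEFin -natr_sum lee_fin ler_nat /cnt -sum1_count big_mkcond/=.
  by rewrite /index_iota subn0; apply: leq_sum => i _; case: (c i).
have [k [m km] kmax] : exists2 k, exists m, cnt m = k & forall m, (cnt m <= k)%N.
  have ex : exists k, `[< exists m, cnt m = k >].
    by exists (cnt 0%N); apply/asboolP; exists 0%N.
  have bd k : `[< exists m, cnt m = k >] -> (k <= n)%N.
    by move=> /asboolP[m <-].
  case: (ex_maxnP ex bd) => k /asboolP km kmax; exists k => // m.
  by apply: kmax; apply/asboolP; exists m.
exists [seq i <- iota 0 m | c i].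
  exact/sorted_filter/iota_ltn_sorted/ltn_trans.
move=> i; rewrite mem_filter mem_iota add0n /=.
case ci : (c i) => //=; symmetry; rewrite ltnNge; apply/negP => mi.
have := kmax i.+1; rewrite leqNgt => /negP; apply.
rewrite -km /cnt -[i.+1]addn1 iotaD count_cat /= add0n ci addn0 addn1 ltnS.
by rewrite -(subnKC mi) iotaD count_cat leq_addr.
Qed.

End indicator_series.

(** * Bernoulli marks *)

(** Pascal's rule: one further mark is true with probability [p] and false with probability
    [1 - p]. *)
Lemma binomial_pmfS (R : realType) (p : R) n i :
  binomial_pmf n.+1 p i.+1 = p * binomial_pmf n p i + (1 - p) * binomial_pmf n p i.+1.
Proof.
rewrite /binomial_pmf binS mulrnDr subSS addrC !mulrnAr; congr (_ *+ _ + _).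
  by rewrite exprS mulrA.
(* For [n < i.+1] the exponent [n - i.+1] is truncated, but the binomial coefficient vanishes. *)
have [ni|ni] := ltnP n i.+1; first by rewrite bin_small.
by congr (_ *+ _); rewrite mulrCA -exprS subnSK.
Qed.

Lemma binomial_pmfS0 (R : realType) (p : R) n :
  binomial_pmf n.+1 p 0 = (1 - p) * binomial_pmf n p 0.
Proof. by rewrite /binomial_pmf !bin0 !expr0 !mul1r !subn0 exprS. Qed.

Section marks.
Context (R : realType) (d : nat) (dO : measure_display)
  (Omega : measurableType dO) (P : probability Omega R)
  (N : R.-ker Omega ~> borelRd R d) (p : R)
  (X : nat -> Omega -> borelRd R d) (U : nat -> Omega -> bool).
Hypothesis marksU : bernoulli_marks P p N X U.

Definition marked (J : seq nat) : set Omega := [set w | forall j, j \in J -> U j w].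

Definition mark_count (S : seq nat) (i : nat) : set Omega :=
  [set w | count (U ^~ w) S = i].

(** Generators of the sigma-algebra on which [bernoulli_marks] conditions. *)
Definition ground_events : set (set Omega) :=
  count_events N `|` \bigcup_i preimage_set_system setT (X i) measurable.

Hypothesis ground_measurable : <<s ground_events >> `<=` measurable.

Lemma measurable_mark i b : measurable [set w | U i w = b].
Proof. by have := marksU.1 i measurableT [set b] I; rewrite setTI. Qed.

Lemma measurable_forall_lt n (F : nat -> set Omega) :
  (forall i, measurable (F i)) ->
  measurable [set w | forall i, (i < n)%N -> F i w].
Proof. by move=> mF; apply: (@bigcap_measurableType _ _ F (fun i => is_true (i < n)%N)). Qed.

Lemma measurable_marked J : measurable (marked J).
Proof.
apply: (@bigcap_measurableType _ _ (fun j => [set w | U j w = true]) (fun j => is_true (j \in J))).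
by move=> i _; exact: measurable_mark.
Qed.

Lemma measurable_mark_count S i : measurable (mark_count S i).
Proof.
rewrite /mark_count; elim: S i => [|s S IH] i /=.
  by case: (eqVneq 0%N i) => [->|/eqP i0]; [rewrite (_ : mkset _ = setT)|rewrite (_ : mkset _ = set0)];
    rewrite // -?subset0// -subTset.
case: i => [|i].
  rewrite (_ : mkset _ = [set w | U s w = false] `&` mark_count S 0).
    by apply: measurableI; [exact: measurable_mark|exact: IH].
  by apply/seteqP; split=> w; rewrite /mark_count /=; case: (U s w) => // -[].
rewrite (_ : mkset _ = ([set w | U s w = true] `&` mark_count S i) `|`
    ([set w | U s w = false] `&` mark_count S i.+1)).
  by apply: measurableU; apply: measurableI; try exact: measurable_mark; exact: IH.
apply/seteqP; split=> w; rewrite /mark_count /=; case: (U s w) => /=; rewrite ?add1n ?add0n.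
- by case=> ->; left.
- by move=> ->; right.
- by move=> [[_ ->//]|[]].
- by move=> [[]|[_ ->//]].
Qed.

Section fixed_event.
Variables (n : nat) (A : set Omega).
Hypothesis ground_A : <<s ground_events >> A.
Hypothesis A_points : A `<=` [set w | (n%:R%:E <= N w setT)%E].

Let mA : measurable A. Proof. exact: ground_measurable. Qed.

Let mprefix k (b : nat -> bool) : measurable [set w | forall i, (i < k)%N -> U i w = b i].
Proof. by apply: measurable_forall_lt => i; exact: measurable_mark. Qed.

Let msuffix (J : seq nat) k : measurable [set w | forall i, (k <= i < n)%N -> i \in J -> U i w].
Proof.
rewrite (_ : mkset _ = marked [seq i <- J | (k <= i < n)%N]); first exact: measurable_marked.
apply/seteqP; split=> w /= H i; first by rewrite mem_filter => /andP[]; exact: H.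
by move=> kin iJ; apply: H; rewrite mem_filter kin.
Qed.

(* Downward induction on k: the marks k, ..., n.-1 are either free or required
   to be true, and freeing one of them sums over its two values. *)
Lemma pr_marked_prefix (J : seq nat) k (b : nat -> bool) : (k <= n)%N ->
  pr P (A `&` [set w | forall i, (i < k)%N -> U i w = b i] `&`
        [set w | forall i, (k <= i < n)%N -> i \in J -> U i w]) =
  pr P A * (\prod_(i < k) bernoulli_pmf p (b i)) *
    \prod_(k <= i < n) (if i \in J then p else 1).
Proof.
move=> kn; have [m mk] : exists m, (n - k)%N = m by exists (n - k)%N.
elim: m k b kn mk => [|m IH] k b kn mk.
  have {mk}-> : k = n by apply/eqP; rewrite eqn_leq kn -subn_eq0 mk.
  rewrite [X in _ `&` X](_ : _ = setT); last first.
    by rewrite -subTset => w _ i; rewrite leqNgt andNb.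
  rewrite setIT big_geq// mulr1; apply: EFin_inj.
  rewrite -prE; last exact: measurableI.
  by rewrite marksU.2// EFinM -prE.
have {mk kn}[kn mk] : (k < n)%N /\ (n - k.+1)%N = m.
  by rewrite -subn_gt0 mk subnS mk.
pose b' c i := if i == k then c else b i.
have b'E c : \prod_(i < k.+1) bernoulli_pmf p (b' c i) =
    (\prod_(i < k) bernoulli_pmf p (b i)) * bernoulli_pmf p c.
  rewrite big_ord_recr /= /b' eqxx; congr (_ * _).
  by apply: eq_bigr => i _; rewrite ltn_eqF.
set E := A `&` _ `&` _; pose Fc c := A `&`
  [set w | forall i, (i < k.+1)%N -> U i w = b' c i] `&`
  [set w | forall i, (k.+1 <= i < n)%N -> i \in J -> U i w].
have mE : measurable E by apply: measurableI; [exact: measurableI|exact: msuffix].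
(* The value [false] is left out when [k] is in [J], since [E] then forces the mark [k] to be
   true. *)
have FcE c : (c || (k \notin J)) -> Fc c = E `&` [set w | U k w = c].
  move=> cJ; apply/seteqP; split=> w.
    move=> [[Aw H1 H2]]; split; last by rewrite /= H1 /b' ?eqxx.
    split; first split=> //.
      by move=> i ik; rewrite H1 /b' ?(ltnW ik)// ?ltn_eqF// ltnS ltnW.
    move=> i /andP[]; rewrite leq_eqVlt => /predU1P[<- _ kJ|ki ilen].
      by rewrite H1 /b' ?eqxx//; move: cJ; rewrite kJ orbF.
    by apply: H2; rewrite ki.
  move=> [[[Aw H1] H2] /= Uk]; split; [split=> //|].
    move=> i; rewrite ltnS leq_eqVlt /b'; case: eqP => [->//|_ /= ik]; exact: H1.
  by move=> i /andP[ki ilen]; apply: H2; rewrite (ltnW ki).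
have -> : pr P E = pr P (E `&` [set w | U k w = true]) + pr P (E `&` [set w | U k w = false]).
  rewrite (pr_setIC P mE (measurable_mark k true)); congr (_ + pr P (_ `&` _)).
  by apply/seteqP; split=> w /=; case: (U k w).
rewrite [in RHS]big_ltn//; case: (boolP (k \in J)) => kJ.
  have -> : E `&` [set w | U k w = false] = set0.
    rewrite -subset0 => w [[_ /= /(_ k)]] + Uk.
    by rewrite leqnn kn Uk => /(_ isT kJ).
  rewrite pr_set0 addr0 -FcE// IH// b'E.
  by rewrite /= !mulrA.
by rewrite -!FcE ?kJ// !IH// !b'E /=; ring.
Qed.

Lemma pr_marked (J : seq nat) : uniq J -> (forall j, j \in J -> (j < n)%N) ->
  pr P (A `&` marked J) = pr P A * p ^+ size J.
Proof.
move=> uJ Jn; have := @pr_marked_prefix J 0 (fun=> true) isT.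
rewrite big_ord0 mulr1 [X in _ `&` X `&` _](_ : _ = setT) ?setIT; last first.
  by rewrite -subTset.
rewrite [X in _ `&` X](_ : _ = marked J); last first.
  apply/seteqP; split=> w /= H j; last by move=> _; exact: H.
  by move=> jJ; apply: H => //; exact: Jn.
move=> ->; congr (_ * _); rewrite -big_mkcond/= -big_filter.
rewrite big_const_seq count_predT iter_mulr_1; congr (_ ^+ _).
apply: perm_size; apply: uniq_perm => //; first exact/filter_uniq/iota_uniq.
move=> j; rewrite mem_filter mem_index_iota /=.
by case: (boolP (j \in J)) => //= /Jn.
Qed.

(** Induction on [S] with [J] arbitrary: if the head of [S] has a true mark it moves to [J], and the
    false case follows by subtraction. So only events that require true marks have to be evaluated
    directly. *)
Lemma pr_mark_count (S J : seq nat) i : uniq (J ++ S) -> (forall j, j \in J ++ S -> (j < n)%N) ->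
  pr P (A `&` marked J `&` mark_count S i) =
  pr P A * p ^+ size J * binomial_pmf (size S) p i.
Proof.
elim: S J i => [|s S IH] J i.
  rewrite cats0 => uJ Jn; rewrite -pr_marked// /binomial_pmf /= sub0n expr0 mulr1.
  case: i => [|i].
    by rewrite bin0 mulr1 (_ : mark_count _ _ = setT) ?setIT// -subTset.
  by rewrite bin0n mulr0n mulr0 (_ : mark_count _ _ = set0) ?setI0 ?pr_set0// -subset0.
move=> uJS JSn.
have Cperm : perm_eq (J ++ s :: S) ((s :: J) ++ S) by apply/permP => a; rewrite /= !count_cat /= addnCA.
have usJS : uniq ((s :: J) ++ S) by rewrite -(perm_uniq Cperm).
have sJSn j : j \in (s :: J) ++ S -> (j < n)%N by rewrite -(perm_mem Cperm); exact: JSn.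
have uJS' : uniq (J ++ S) by move: usJS => /andP[].
have JSn' j : j \in J ++ S -> (j < n)%N.
  by move=> jJS; apply: sJSn; rewrite in_cons jJS orbT.
have mJS i' : measurable (A `&` marked J `&` mark_count S i').
  by apply: measurableI; [apply: measurableI => //; exact: measurable_marked|exact: measurable_mark_count].
have sE i' : A `&` marked J `&` mark_count S i' `&` [set w | U s w = true] =
    A `&` marked (s :: J) `&` mark_count S i'.
  apply/seteqP; split=> w.
    move=> [[[Aw JU] Si]] Us; split=> //; split=> // j.
    by rewrite in_cons => /predU1P[->//|]; exact: JU.
  move=> [[Aw JU] Si]; split; first split=> //; last by apply: JU; rewrite mem_head.
  by split=> // j jJ; apply: JU; rewrite in_cons jJ orbT.
have sF i' : pr P (A `&` marked J `&` mark_count S i' `&` ~` [set w | U s w = true]) =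
    pr P A * p ^+ size J * ((1 - p) * binomial_pmf (size S) p i').
  have := pr_setIC P (mJS i') (measurable_mark s true).
  by rewrite sE !IH//= exprS => H; lra.
have mL : measurable (A `&` marked J `&` mark_count (s :: S) i).
  by apply: measurableI; [apply: measurableI => //; exact: measurable_marked|exact: measurable_mark_count].
rewrite (pr_setIC P mL (measurable_mark s true)).
have -> : A `&` marked J `&` mark_count (s :: S) i `&` ~` [set w | U s w = true] =
    A `&` marked J `&` mark_count S i `&` ~` [set w | U s w = true].
  by apply/seteqP; split=> w /= [[H]]; rewrite /mark_count /=; case: (U s w).
rewrite sF; case: i {mL} => [|i].
  rewrite [X in pr P X](_ : _ = set0) ?pr_set0 ?add0r ?binomial_pmfS0//.
  by rewrite -subset0 => w [[_]]; rewrite /mark_count /= => + Us; rewrite Us.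
have -> : A `&` marked J `&` mark_count (s :: S) i.+1 `&` [set w | U s w = true] =
    A `&` marked J `&` mark_count S i `&` [set w | U s w = true].
  apply/seteqP; split=> w [[H]]; rewrite /mark_count /= => + Us; rewrite Us.
    by rewrite add1n => -[->].
  by move=> ->.
by rewrite sE IH//= binomial_pmfS exprS; ring.
Qed.

End fixed_event.
End marks.

(** * The thinning formula *)

Section thinned_process.
Context (R : realType) (d : nat) (dO : measure_display)
  (Omega : measurableType dO) (P : probability Omega R)
  (N N1 N2 : R.-ker Omega ~> borelRd R d) (p : R)
  (X : nat -> Omega -> borelRd R d) (U : nat -> Omega -> bool).
Hypothesis N_point_process : point_process N.
Hypothesis NX : enumerates N X.
Hypothesis marksU : bernoulli_marks P p N X U.
Hypothesis N1_thinning : forall w B, measurable B -> N1 w B =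
  (\sum_(0 <= i <oo | (i%:R%:E < N w setT) && U i w) \d_(X i w) B)%E.
Hypothesis N2_complement :
  forall w B, measurable B -> N w B = (N1 w B + N2 w B)%E.
Implicit Types (B C : set (borelRd R d)) (D A : set Omega).

Let point_in B i w : bool := (i%:R%:E < N w setT)%E && (X i w \in B).

Let N_series w B : measurable B ->
  (N w B = \sum_(0 <= i <oo) (point_in B i w)%:R%:E)%E.
Proof.
move=> mB; rewrite NX.2// eseries_mkcond; apply: eq_eseriesr => i _.
by rewrite /point_in; case: ifP => //= _; rewrite diracE.
Qed.

Let N1_series w B : measurable B ->
  (N1 w B = \sum_(0 <= i <oo) (point_in B i w && U i w)%:R%:E)%E.
Proof.
move=> mB; rewrite N1_thinning// eseries_mkcond; apply: eq_eseriesr => i _.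
rewrite /point_in; case: (_ < _)%E => //=.
by case: (U i w); rewrite ?andbF// andbT diracE.
Qed.

(** The total mass may be infinite, and [point_process] speaks of bounded sets only. By the
    enumeration it is a sum of ones, and the indices 0, ..., i all contribute. *)
Let lt_mass_succ w i : (i%:R%:E < N w setT)%E -> (i.+1%:R%:E <= N w setT)%E.
Proof.
move=> iN; rewrite [leRHS]N_series//.
apply: le_trans (nneseries_lim_ge i.+1 _) => //.
rewrite (eq_big_nat _ _ (F2 := fun=> 1%E)); last first.
  move=> j /andP[_]; rewrite ltnS => ji.
  rewrite /point_in in_setT andbT (le_lt_trans _ iN)//.
  by rewrite lee_fin ler_nat.
by rewrite sumEFin sumr_const_nat subn0.
Qed.

Let ground := ground_events N X.

Let ground_measurable : <<s ground >> `<=` measurable.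
Proof.
apply: smallest_sub; first exact: sigma_algebra_measurable.
move=> _ [[B mB [E mE <-]]|[i _ [E mE <-]]].
  exact: (measurable_kernel N B mB measurableT).
exact: NX.1.
Qed.

(** Omega with the smaller sigma-algebra of N and X: measurability here is what [bernoulli_marks]
    asks of an event. *)
Let groundT := g_sigma_algebraType ground.

Let ground_N B : measurable B -> measurable_fun (setT : set groundT) (N ^~ B).
Proof.
move=> mB _ E mE; apply: sub_sigma_algebra; left; exists B => //.
by exists E.
Qed.

Let ground_X i : measurable_fun (setT : set groundT) (X i).
Proof.
by move=> _ E mE; apply: sub_sigma_algebra; right; exists i => //; exists E.
Qed.

Let ground_point_in B i : measurable B ->
  measurable ([set w | point_in B i w] : set groundT).
Proof.
move=> mB.
have -> : [set w | point_in B i w] =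
    [set w | (i%:R%:E < N w setT)%E] `&` X i @^-1` B.
  apply/seteqP; split=> w.
    by move=> /= /andP[-> /set_mem].
  by move=> /= [iN XB]; rewrite /point_in iN mem_set.
apply: measurableI.
  rewrite -[X in measurable X]setTI.
  by apply: emeasurable_fun_o_infty => //; exact: ground_N.
by rewrite -[X in measurable X]setTI; exact: ground_X.
Qed.

(** Only acceptances are prescribed, never rejections: the family is then stable under intersection
    and fits the list [J] of [pr_mark_count], and complements recover the rejections. *)
Definition outside_generators B : set (set Omega) :=
  [set E | exists A (J : seq nat), <<s ground >> A /\
     E = A `&` [set w | forall j, j \in J -> point_in (~` B) j w && U j w]].

(* The events determined by N, the enumeration X, and the marks of those
   points of N that lie outside B. *)
Definition outside B : set (set Omega) := <<s outside_generators B >>.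

Let measurable_point_in B i : measurable B -> measurable [set w | point_in B i w].
Proof. by move=> mB; apply: ground_measurable; exact: ground_point_in. Qed.

Lemma outside_measurable B D : measurable B -> outside B D -> measurable D.
Proof.
move=> mB; apply: smallest_sub; first exact: sigma_algebra_measurable.
move=> _ [A [J [gA ->]]]; apply: measurableI; first exact: ground_measurable.
apply: (@bigcap_measurableType _ _
  (fun j => [set w | point_in (~` B) j w && U j w]) (fun j => is_true (j \in J))).
move=> j _; have -> : [set w | point_in (~` B) j w && U j w] =
    [set w | point_in (~` B) j w] `&` [set w | U j w = true].
  by apply/seteqP; split=> w /=; [move=> /andP[]|move=> [-> ->]].
apply: measurableI; first exact/measurable_point_in/measurableC.
exact: (measurable_mark marksU).
Qed.

Let mNB B n : measurable B -> measurable [set w | N w B = n%:R%:E].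
Proof.
move=> mB; have := measurable_kernel N B mB measurableT [set n%:R%:E].
by rewrite setTI; apply; exact: emeasurable_set1.
Qed.

Let mN1B B n : measurable B -> measurable [set w | N1 w B = n%:R%:E].
Proof.
move=> mB; have := measurable_kernel N1 B mB measurableT [set n%:R%:E].
by rewrite setTI; apply; exact: emeasurable_set1.
Qed.

(** Once the list [S] of the indices of the points in [B] is fixed, N1(B) is the number of true
    marks in [S]. The marks that [D] prescribes belong to points outside [B], hence to indices not
    in [S], and [pr_mark_count] applies. *)
Let thinning_generator B n i D : measurable B -> outside_generators B D ->
  pr P (D `&` [set w | N w B = n%:R%:E] `&` [set w | N1 w B = i%:R%:E]) =
  pr P (D `&` [set w | N w B = n%:R%:E]) * binomial_pmf n p i.
Proof.
move=> mB gD; have mD : measurable D.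
  by apply: (outside_measurable mB); exact: sub_sigma_algebra.
pose F (S : seq nat) := [set w | sorted ltn S /\ forall i, point_in B i w = (i \in S)].
have groundF S : measurable (F S : set groundT).
  rewrite /F; case: (boolP (sorted ltn S)) => sS; last first.
    by rewrite (_ : mkset _ = set0)// -subset0 => w [].
  rewrite (_ : mkset _ = \bigcap_i [set w | point_in B i w = (i \in S)]); last first.
    by apply/seteqP; split=> [w [_ H] j _|w H]; [exact: H|split=> // j; exact: H].
  apply: bigcap_measurableType => j _.
  case: (j \in S); first exact: ground_point_in.
  rewrite (_ : mkset _ = ~` [set w | point_in B j w]).
    by apply: (@measurableC _ groundT); exact: ground_point_in.
  by apply/seteqP; split=> w /=; [move=> ->|move/negP/negbTE].
rewrite -[LHS]mul1r [RHS]mulrC; apply: (pr_partition (F := F)).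
- by move=> S; apply: ground_measurable; exact: groundF.
- by apply: measurableI; [exact/measurableI/mNB|exact: mN1B].
- exact/measurableI/mNB.
- move=> S S' w [sS FS] [sS' FS']; apply: (irr_sorted_eq ltn_trans ltnn) => // j.
  by rewrite -FS FS'.
- move=> w Hw; have : N w B = n%:R%:E by case: Hw => [[[]]|[]].
  by rewrite N_series// => /eseries_indic_fin[S sS FS]; exists S.
move=> S.
case: (boolP (sorted ltn S && (size S == n))) => [/andP[sS /eqP sn]|Sn]; last first.
  have NF w : N w B = n%:R%:E -> F S w -> False.
    move=> + [sS FS]; rewrite N_series// (eseries_indic _ (sorted_uniq ltn_trans ltnn sS) FS).
    by move=> /natr_EFin_inj sn; rewrite sS sn eqxx in Sn.
  have DF0 : D `&` [set w | N w B = n%:R%:E] `&` F S = set0.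
    by rewrite -subset0 => w [[_ +] FS]; move=> /NF/(_ FS).
  by rewrite setIAC DF0 set0I pr_set0 !mulr0.
have uS := sorted_uniq ltn_trans ltnn sS.
have FN w : F S w -> N w B = n%:R%:E.
  by move=> [_ FS]; rewrite N_series// (eseries_indic _ uS FS) sn.
have FN1 w : F S w -> N1 w B = (count (U ^~ w) S)%:R%:E.
  move=> [_ FS]; rewrite N1_series// -size_filter; apply: eseries_indic.
    exact: filter_uniq.
  by move=> j; rewrite mem_filter FS andbC.
have -> : D `&` [set w | N w B = n%:R%:E] `&` [set w | N1 w B = i%:R%:E] `&` F S =
    D `&` F S `&` mark_count U S i.
  apply/seteqP; split=> w.
    by move=> [[[Dw _]]] /= + FS; rewrite FN1// => /natr_EFin_inj ci; split.
  move=> [[Dw FS] ci]; split=> //; split; last by rewrite /= FN1// ci.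
  by split=> //; exact: FN.
have -> : D `&` [set w | N w B = n%:R%:E] `&` F S = D `&` F S.
  apply/seteqP; split=> w; first by move=> [[Dw _] FS]; split.
  by move=> [Dw FS]; split=> //; split=> //; exact: FN.
have [A [J0 [gA DE]]] := gD; pose J := undup J0.
have {}DE : D = A `&` [set w | forall j, j \in J -> point_in (~` B) j w && U j w].
  rewrite DE; apply/seteqP; split=> w [Aw H]; split=> // j.
    by rewrite mem_undup; exact: H.
  by move=> jJ; apply: H; rewrite mem_undup.
pose A' := A `&` [set w | forall j, j \in J -> point_in (~` B) j w] `&` F S.
have DA' : D `&` F S = A' `&` marked U J.
  rewrite DE; apply/seteqP; split=> w.
    move=> [[Aw H] FS]; split; last by move=> j /H/andP[].
    by split=> //; split=> // j /H/andP[].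
  move=> [[[Aw H] FS] H']; split=> //; split=> // j jJ.
  by rewrite H//= H'.
(* An index common to [J] and [S] would denote a point both inside and outside [B], so the cell is
   then empty. *)
rewrite DA'; case: (boolP (uniq (J ++ S))) => uJS; last first.
  have A'0 : A' = set0.
    rewrite -subset0 => w [[_ H] [_ FS]]; move: uJS.
    rewrite cat_uniq undup_uniq uS andbT /= negbK => /hasP[j jS jJ].
    have := H _ jJ; have := FS j; rewrite jS /point_in => /andP[-> /set_mem XB].
    by rewrite in_setC mem_set.
  by rewrite A'0 !set0I pr_set0 !mulr0.
have gA' : <<s ground >> A'.
  suff : measurable (A' : set groundT) by [].
  apply: measurableI => //; apply: measurableI => //.
  apply: (@bigcap_measurableType _ groundT
    (fun j => [set w | point_in (~` B) j w]) (fun j => is_true (j \in J))).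
  move=> j _; apply: ground_point_in; exact: measurableC.
(* A strict bound on all the indices involved; on [A'] each of them denotes an actual point, so N
   has at least [n'] points. *)
pose n' := (\max_(j <- J ++ S) j.+1)%N.
have A'n : A' `<=` [set w | (n'%:R%:E <= N w setT)%E].
  move=> w [[_ H] [_ FS]] /=; rewrite /n' big_seq.
  elim/big_ind: _ => [|a b|]; [exact: measure_ge0|by rewrite /maxn; case: ifP|].
  move=> j; rewrite mem_cat => /orP[/H|]; last rewrite -FS.
    by move=> /andP[/lt_mass_succ].
  by move=> /andP[/lt_mass_succ].
have JSn j : j \in J ++ S -> (j < n')%N.
  by move=> jJS; apply: (leq_bigmax_seq (F := succn)).
rewrite (pr_mark_count marksU ground_measurable gA' A'n)// sn.
rewrite (pr_marked marksU ground_measurable gA' A'n) ?undup_uniq//; last first.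
  by move=> j jJ; apply: JSn; rewrite mem_cat jJ.
by rewrite mul1r mulrC.
Qed.

Let outside_generatorsI B : setI_closed (outside_generators B).
Proof.
move=> _ _ [A [J [gA ->]]] [A' [J' [gA' ->]]]; exists (A `&` A'), (J ++ J'); split.
  by apply: (@measurableI _ groundT).
apply/seteqP; split=> w.
  move=> [[Aw H] [A'w H']]; split=> // j; rewrite mem_cat.
  by move=> /orP[/H|/H'].
by move=> [[Aw A'w] H]; split; split=> // j jJ; apply: H; rewrite mem_cat jJ ?orbT.
Qed.

Lemma outside_setI B D D' : outside B D -> outside B D' -> outside B (D `&` D').
Proof.
move=> oD oD'.
exact: (@measurableI _ (g_sigma_algebraType (outside_generators B))).
Qed.

Lemma outside_setT B : outside B setT.
Proof. exact: (@measurableT _ (g_sigma_algebraType (outside_generators B))). Qed.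

(** Both sides are countably additive in [D] and agree on a generating pi-system. The complement
    step subtracts the identity for [G] from the one for Omega. *)
Lemma thinning_outside B n i D : measurable B -> outside B D ->
  pr P (D `&` [set w | N w B = n%:R%:E] `&` [set w | N1 w B = i%:R%:E]) =
  pr P (D `&` [set w | N w B = n%:R%:E]) * binomial_pmf n p i.
Proof.
move=> mB; set E := [set w | N w B = _]; set E1 := [set w | N1 w B = _].
have mE : measurable E by exact: mNB.
have mE1 : measurable E1 by exact: mN1B.
pose ok D := pr P (D `&` E `&` E1) = pr P (D `&` E) * binomial_pmf n p i.
have okT : ok setT.
  apply: thinning_generator => //; exists setT, [::]; split.
    exact: (@measurableT _ groundT).
  by apply/esym; rewrite setTI -subTset.
have oM := @outside_measurable B _ mB.
have okC G : outside B G -> ok G -> ok (~` G).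
  move=> /oM mD; rewrite /ok => okD.
  have mEE : measurable (E `&` E1) by exact: measurableI.
  have := pr_setIC P mEE mD; have := pr_setIC P mE mD.
  move: okT okD; rewrite /ok !setTI -!(setIA _ E E1) !(setIC G) !(setIC (~` G)).
  move=> -> -> ->; rewrite mulrDl => /addrI/esym; exact.
have okU (F : nat -> set Omega) : (forall n, outside B (F n)) ->
    trivIset setT F -> (forall n, ok (F n)) -> ok (\bigcup_k F k).
  move=> oF tF okF; rewrite /ok -[LHS]mul1r [RHS]mulrC.
  have mF k : measurable (F k) by exact: oM.
  apply: (pr_partition (F := F)) => //.
  + by apply: measurableI => //; apply: measurableI => //; exact: bigcup_measurable.
  + by apply: measurableI => //; exact: bigcup_measurable.
  + by move=> j k w Fj Fk; apply: tF => //; exists w.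
  + by move=> w [[[[k _ Fk] _] _]|[[k _ Fk] _]]; exists k.
  move=> k; have subF (G : set Omega) : \bigcup_k F k `&` G `&` F k = F k `&` G.
    apply/seteqP; split=> w; first by move=> [[_ Gw] Fk].
    by move=> [Fk Gw]; split=> //; split=> //; exists k.
  by rewrite mul1r mulrC -(setIA _ E E1) !subF setIA; exact: okF.
move: D; apply: (@dynkin_induction _ (g_sigma_algebraType (outside_generators B))
  (outside_generators B) ok) => //; first by move=> D gD; exact: thinning_generator.
Qed.

Lemma outside_N B C E : measurable C -> measurable E -> outside B (N ^~ C @^-1` E).
Proof.
move=> mC mE; apply: sub_sigma_algebra; exists (N ^~ C @^-1` E), [::]; split.
  by have := ground_N mC measurableT mE; rewrite setTI.
by rewrite [X in _ `&` X](_ : _ = setT) ?setIT// -subTset.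
Qed.

Let outsideT B := g_sigma_algebraType (outside_generators B).

Let outside_fun_N B C : measurable C ->
  measurable_fun (setT : set (outsideT B)) (N ^~ C).
Proof. by move=> mC _ E mE; rewrite setTI; exact: outside_N. Qed.

(** N1(C) is a countable sum of indicators of accepted points in [C]; these points lie outside [B],
    so each indicator comes from a generator with a one-element [J]. *)
Let outside_fun_N1 B C : measurable B -> measurable C -> B `&` C = set0 ->
  measurable_fun (setT : set (outsideT B)) (N1 ^~ C).
Proof.
move=> mB mC BC.
rewrite (_ : N1 ^~ C = fun w => (\sum_(0 <= i <oo | i \in xpredT)
    (\1_[set w | point_in C i w && U i w] w)%:E)%E); last first.
  apply/funext => w; rewrite N1_series//; apply: eq_eseriesr => i _.
  rewrite indicE; congr ((nat_of_bool _)%:R%:E).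
  by apply/idP/idP => [Ci|/set_mem//]; exact/mem_set.
apply: ge0_emeasurable_sum => // i _.
apply/measurable_EFinP; apply: measurable_indic.
rewrite (_ : mkset _ = (X i @^-1` C) `&`
  [set w | forall j, j \in [:: i] -> point_in (~` B) j w && U j w]); last first.
  apply/seteqP; split=> w /=.
    move=> /andP[/andP[iN /set_mem XC] Ui]; split=> // j; rewrite inE => /eqP ->.
    rewrite /point_in iN Ui /= andbT; apply/mem_set => XB.
    by have : (B `&` C) (X i w) by []; rewrite BC.
  move=> [XC /(_ i)]; rewrite mem_head => /(_ isT) /andP[/andP[iN _] ->].
  by rewrite /point_in iN mem_set.
apply: sub_sigma_algebra; exists (X i @^-1` C), [:: i]; split=> //.
by have := ground_X i measurableT mC; rewrite setTI.
Qed.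

Lemma outside_N1 B C E : measurable B -> measurable C -> B `&` C = set0 ->
  measurable E -> outside B (N1 ^~ C @^-1` E).
Proof.
move=> mB mC BC mE.
by have := outside_fun_N1 mB mC BC measurableT mE; rewrite setTI.
Qed.

Lemma count_N12 w B : measurable B -> bounded_set (B : set 'rV[R]_d) ->
  exists i j : nat, [/\ N1 w B = i%:R%:E, N2 w B = j%:R%:E & N w B = (i + j)%:R%:E].
Proof.
move=> mB bB; have [n Nn] := N_point_process w mB bB.
have [S sS FS] : exists2 S, sorted ltn S & forall i, point_in B i w = (i \in S).
  by apply: (@eseries_indic_fin R _ n); rewrite -N_series.
have N1S : N1 w B = (count (U ^~ w) S)%:R%:E.
  rewrite N1_series// -size_filter; apply: eseries_indic.
    exact/filter_uniq/(sorted_uniq ltn_trans ltnn).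
  by move=> j; rewrite mem_filter FS andbC.
have nS : n = size S.
  have := N_series w mB; rewrite Nn (eseries_indic _ (sorted_uniq ltn_trans ltnn sS) FS).
  exact: natr_EFin_inj.
have N2S : N2 w B = (count (predC (U ^~ w)) S)%:R%:E.
  have := N2_complement w mB; rewrite Nn N1S nS -(count_predC (U ^~ w)).
  by move=> /natr_EFin_addI.
exists (count (U ^~ w) S), (count (predC (U ^~ w)) S); split=> //.
by rewrite count_predC -nS.
Qed.

(** For bounded [C] all counts are finite, so N2(C) is the genuine difference N(C) - N1(C). *)
Lemma outside_N2 B C E : measurable B -> measurable C -> B `&` C = set0 ->
  bounded_set (C : set 'rV[R]_d) ->
  measurable E -> outside B (N2 ^~ C @^-1` E).
Proof.
move=> mB mC BC bC mE.
suff H : measurable_fun (setT : set (outsideT B)) (N2 ^~ C).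
  by have := H measurableT E mE; rewrite setTI.
rewrite (_ : N2 ^~ C = fun w => (N w C - N1 w C)%E); last first.
  apply/funext => w; have [i [j [-> -> ->]]] := count_N12 w mC bC.
  by rewrite -EFinB natrD addrAC subrr add0r.
by apply: emeasurable_funB; [exact: outside_fun_N|exact: outside_fun_N1].
Qed.

Lemma thinning_count B i j D : measurable B -> bounded_set (B : set 'rV[R]_d) ->
  outside B D ->
  pr P (D `&` [set w | N1 w B = i%:R%:E] `&` [set w | N2 w B = j%:R%:E]) =
  pr P (D `&` [set w | N w B = (i + j)%:R%:E]) * binomial_pmf (i + j) p i.
Proof.
move=> mB bB oD; rewrite -thinning_outside//; congr pr.
apply/seteqP; split=> w [[Dw /=]].
  move=> N1i N2j; split=> //; split=> //=.
  by rewrite N2_complement// N1i N2j -EFinD natrD.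
move=> Nij N1i; split=> //=; have := N2_complement w mB.
by rewrite Nij N1i => /natr_EFin_addI.
Qed.

End thinned_process.

(** * Poisson masses and count events *)

Section poisson_distribution.
Context (R : realType).
Implicit Types (x : R) (n : nat).

Lemma expR_eseries x : 0 <= x ->
  (\sum_(0 <= n <oo) (x ^+ n / n`!%:R)%:E = (expR x)%:E)%E.
Proof.
move=> x0; rewrite expRE -EFin_lim; last first.
  rewrite /pseries/=; under eq_fun do rewrite mulrC.
  exact: is_cvg_series_exp_coeff.
apply/congr_lim/funext => n/=; rewrite /pseries/= /series/= -sumEFin//.
by under eq_bigr do rewrite mulrC.
Qed.

(** Since [0 ^+ 0 = 1], this is the Dirac mass at 0 when [x = 0], and rate 0 needs no separate
    treatment later. *)
Definition poisson_mass x n : R := expR (- x) * (x ^+ n / n`!%:R).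

Lemma poisson_mass_ge0 x n : 0 <= x -> 0 <= poisson_mass x n.
Proof. by move=> x0; rewrite mulr_ge0 ?expR_ge0// divr_ge0// exprn_ge0. Qed.

Lemma poisson_probE x n : 0 <= x -> poisson_prob x 0 [set n] = (poisson_mass x n)%:E.
Proof.
rewrite /poisson_prob le_eqVlt => /predU1P[<-|x0].
  rewrite ltxx diracE /poisson_mass oppr0 expR0 mul1r.
  case: n => [|n]; first by rewrite mem_set// expr0 fact0 divr1.
  by rewrite expr0n mul0r memNset.
rewrite x0 esum_set1; last by rewrite lee_fin poisson_pmf_ge0.
by rewrite /poisson_pmf x0 /poisson_mass mulrC.
Qed.

Lemma poisson_mass_eseries x : 0 <= x ->
  (\sum_(0 <= n <oo) (poisson_mass x n)%:E = 1%E)%E.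
Proof.
move=> x0; under eq_eseriesr do rewrite /poisson_mass EFinM.
rewrite nneseriesZl ?expR_eseries//; last first.
  by move=> n _; rewrite lee_fin divr_ge0// exprn_ge0.
by rewrite -EFinM expRN mulVf// gt_eqF// expR_gt0.
Qed.

(** Index shift: n + 1 times the mass at n + 1 is x times the mass at n. *)
Lemma poisson_mean x : 0 <= x ->
  (\sum_(0 <= n <oo) (n%:R * poisson_mass x n)%:E = x%:E)%E.
Proof.
move=> x0; rewrite nneseries_recl //; last first.
  by move=> n _; rewrite lee_fin mulr_ge0// poisson_mass_ge0.
rewrite mul0r add0e -nneseries_addn; last first.
  by move=> n; rewrite lee_fin mulr_ge0// poisson_mass_ge0.
rewrite (eq_eseriesr (g := fun n => (x%:E * (poisson_mass x n)%:E)%E)).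
  rewrite nneseriesZl ?poisson_mass_eseries ?mule1// => n _.
  by rewrite lee_fin poisson_mass_ge0.
move=> n _; rewrite addn1 -EFinM /poisson_mass factS natrM exprS; congr EFin.
by field; rewrite pnatr_eq0 -lt0n fact_gt0 addrC natr1 pnatr_eq0.
Qed.

End poisson_distribution.

Section count_events.
Context (R : realType) (d : nat) (dO : measure_display)
  (Omega : measurableType dO) (P : probability Omega R).
Implicit Types (M : R.-ker Omega ~> borelRd R d) (B : set (borelRd R d)).

Definition count_eq M B n : set Omega := [set w | M w B = n%:R%:E].

Lemma count_events_measurable M : <<s count_events M >> `<=` measurable.
Proof.
apply: smallest_sub; first exact: sigma_algebra_measurable.
move=> _ [B mB [E mE <-]].
exact: (measurable_kernel M B mB measurableT).
Qed.

Lemma count_events_eq M B n : measurable B -> <<s count_events M >> (count_eq M B n).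
Proof.
move=> mB; apply: sub_sigma_algebra; exists B => //.
by exists [set n%:R%:E]; [exact: emeasurable_set1|rewrite setTI].
Qed.

Lemma count_events_setI M D E : <<s count_events M >> D -> <<s count_events M >> E ->
  <<s count_events M >> (D `&` E).
Proof. exact: (@measurableI _ (g_sigma_algebraType (count_events M))). Qed.

Lemma measurable_count_eq M B n : measurable B -> measurable (count_eq M B n).
Proof. by move=> mB; apply: (@count_events_measurable M); exact: count_events_eq. Qed.

Lemma measurable_preimage_kernel M B E : measurable B -> measurable E ->
  measurable (M ^~ B @^-1` E).
Proof. by move=> mB mE; have := measurable_kernel M B mB measurableT E mE; rewrite setTI. Qed.

Definition counts_eq M (I : Type) (C : I -> set (borelRd R d)) (a : I -> nat) :
  set Omega := [set w | forall k, count_eq M (C k) (a k) w].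

Lemma counts_eq_bigcap M (I : Type) (C : I -> set (borelRd R d)) (a : I -> nat) :
  counts_eq M C a = \bigcap_k count_eq M (C k) (a k).
Proof. by apply/seteqP; split=> w H k; [move=> _; exact: H|exact: H]. Qed.

Lemma count_events_eqs M (I : finType) (C : I -> set (borelRd R d)) (a : I -> nat) :
  (forall k, measurable (C k)) -> <<s count_events M >> (counts_eq M C a).
Proof.
move=> mC; suff : measurable (counts_eq M C a : set (g_sigma_algebraType (count_events M))) by [].
rewrite counts_eq_bigcap; apply: fin_bigcap_measurable => // k _.
exact: count_events_eq.
Qed.

Definition bounded_borel B := measurable B /\ bounded_set (B : set 'rV[R]_d).

(** A pi-system: with arbitrary finite index types, the intersection of two such events is indexed
    by the sum type. Bounded sets keep the counts finite. *)
Definition bounded_counts M : set (set Omega) :=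
  [set E | exists (I : finType) (C : I -> set (borelRd R d)) (a : I -> nat),
     (forall k, bounded_borel (C k)) /\ E = counts_eq M C a].

Lemma bounded_countsI M : setI_closed (bounded_counts M).
Proof.
move=> _ _ [I [C [a [bC ->]]]] [J [D [b [bD ->]]]].
exists (I + J)%type, (fun k => match k with inl i => C i | inr j => D j end),
  (fun k => match k with inl i => a i | inr j => b j end).
split; first by case.
apply/seteqP; split=> w; first by move=> [HC HD] [i|j]; [exact: HC|exact: HD].
by move=> H; split=> k; [exact: (H (inl k))|exact: (H (inr k))].
Qed.

Lemma bounded_counts_measurable M : bounded_counts M `<=` measurable.
Proof.
move=> _ [I [C [a [bC ->]]]]; apply: (@count_events_measurable M).
by apply: count_events_eqs => k; case: (bC k).
Qed.

Lemma bounded_borel_sub B C : measurable B -> bounded_borel C -> B `<=` C ->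
  bounded_borel B.
Proof.
move=> mB [_ bC] BC; split => //; move: bC; rewrite /bounded_set /bounded_near /=.
by apply: filterS => M HM x /BC; exact: HM.
Qed.

Lemma bounded_borel_ball (k : nat) : bounded_borel (ball (0 : 'rV[R]_d) k%:R).
Proof.
split; first by apply: sub_sigma_algebra; exact: ball_open.
exists k%:R; split=> // M kM x; rewrite -ball_normE /= sub0r normrN => xk.
exact/ltW/(lt_trans xk).
Qed.

(** For bounded [B] the count takes countably many values, so its preimages are countable unions of
    events [count_eq]. A general [B] is the increasing union of its intersections with balls, and
    its count is the limit of theirs. *)
Lemma count_events_bounded M :
  (forall w B, bounded_borel B -> exists n, count_eq M B n w) ->
  <<s count_events M >> `<=` <<s bounded_counts M >>.
Proof.
move=> cM; pose T := g_sigma_algebraType (bounded_counts M).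
have mM B : bounded_borel B -> measurable_fun (setT : set T) (M ^~ B).
  move=> bB _ E mE; rewrite setTI.
  rewrite (_ : _ @^-1` _ = \bigcup_(n in [set n | E n%:R%:E]) count_eq M B n).
    apply: (@bigcup_measurable _ T) => n _; apply: sub_sigma_algebra.
    exists unit, (fun=> B), (fun=> n); split=> //.
    by apply/seteqP; split=> w; [move=> Mn k|move=> /(_ tt)].
  apply/seteqP; split=> w; last first.
    by move=> [n /= En Mn]; rewrite (Mn : M w B = _).
  by move=> Ew; have [n Mn] := cM w B bB; exists n; [move: Ew; rewrite /preimage/= (Mn : M w B = _)|].
apply: smallest_sub; first exact: smallest_sigma_algebra.
move=> _ [B mB [E mE <-]].
pose Bk (k : nat) : set (borelRd R d) := B `&` ball (0 : 'rV[R]_d) k%:R.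
have mBk k : measurable (Bk k) by apply: measurableI => //; case: (bounded_borel_ball k).
suff H : measurable_fun (setT : set T) (M ^~ B) by exact: H.
apply: (@emeasurable_fun_cvg _ T R setT (fun k => M ^~ (Bk k))).
  move=> k; apply: mM; apply: bounded_borel_sub (bounded_borel_ball k) _ => //.
  exact: subIsetr.
move=> w _; have BE : B = \bigcup_k Bk k.
  apply/seteqP; split=> x; last by move=> [k _ []].
  move=> Bx; exists (Num.truncn `|x|).+1 => //; split=> //.
  by rewrite -ball_normE /= sub0r normrN truncnS_gt.
rewrite [in X in _ --> X]BE; apply: nondecreasing_cvg_mu => //.
  exact: bigcup_measurable.
move=> i j ij; apply/subsetPset => x [Bx xi]; split=> //.
by apply: le_ball xi; rewrite ler_nat.
Qed.

End count_events.

Lemma ord_recr_forall m (Q : 'I_m.+1 -> Prop) :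
  (forall k, Q k) <-> (forall k : 'I_m, Q (widen_ord (leqnSn m) k)) /\ Q ord_max.
Proof.
split=> [H|[H Hm] k]; first by split.
case: (unliftP ord_max k) => [j|] -> //.
rewrite (_ : lift _ _ = widen_ord (leqnSn m) j); first exact: H.
by apply: val_inj; rewrite /= /bump leqNgt ltn_ord.
Qed.

(** Atoms of the finite Boolean algebra generated by the [B i], one for each membership pattern
    [I -> bool]. *)
Lemma bounded_atoms (R : realType) (d : nat) (I : finType)
    (B : I -> set (borelRd R d)) : (forall i, bounded_borel (B i)) ->
  exists (m : nat) (C : 'I_m -> set (borelRd R d)) (Q : I -> pred 'I_m),
  [/\ forall k, bounded_borel (C k), trivIset setT C &
      forall i, B i = \big[setU/set0]_(k < m | Q i k) C k].
Proof.
move=> bB; pose T := {ffun I -> bool}.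
pose label x : T := [ffun i => x \in B i].
(* The pattern that is false everywhere describes the complement of the union, which need not be
   bounded; the empty set replaces it. *)
pose C (k : 'I_#|T|) : set (borelRd R d) :=
  if [exists i, enum_val k i] then [set x | label x = enum_val k] else set0.
exists #|T|, C, (fun i (k : 'I_#|T|) => (enum_val k : T) i); split.
- move=> k; rewrite /C; case: ifPn => [/existsP[i ki]|_]; last first.
    split; first exact: measurable0.
    by exists 0; split=> // M _ x [].
  apply: bounded_borel_sub (bB i) _.
    rewrite (_ : mkset _ = \bigcap_i [set x | (x \in B i) = enum_val k i]); last first.
      apply/seteqP; split=> x; first by move=> /= <- j _; rewrite /= ffunE.
      by move=> H; apply/ffunP => j; rewrite ffunE; exact: H.
    apply: fin_bigcap_measurable => // j _; have [mBj _] := bB j.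
    case: (enum_val k j).
      by rewrite (_ : mkset _ = B j)//; apply/seteqP; split=> x; [exact: set_mem|exact: mem_set].
    rewrite (_ : mkset _ = ~` B j); first exact: measurableC.
    apply/seteqP; split=> x; last exact: memNset.
    by move=> /= + Bx; rewrite mem_set.
  by move=> x /= xk; apply/set_mem; move: ki; rewrite -xk ffunE.
- move=> k k' _ _ [x []]; rewrite /C; case: ifP => // _ /= xk; case: ifP => // _ /= xk'.
  by apply: enum_val_inj; rewrite -xk -xk'.
move=> i; rewrite -bigcup_seq_cond /=; apply/seteqP; split=> x.
  move=> Bx; exists (enum_rank (label x)).
    by rewrite /= mem_index_enum /= enum_rankK ffunE mem_set.
  rewrite /C enum_rankK; case: ifPn => // /existsP[]; exists i.
  by rewrite ffunE mem_set.
move=> [k /= /andP[_ ki]]; rewrite /C; case: ifP => // _ /= xk.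
by apply/set_mem; move: ki; rewrite -xk ffunE.
Qed.

(** * Independence of the thinned processes and the Poisson property *)

Section thinning_pair.
Context (R : realType) (d : nat) (dO : measure_display)
  (Omega : measurableType dO) (P : probability Omega R)
  (N N1 N2 : R.-ker Omega ~> borelRd R d) (p : R).
Implicit Types (B : set (borelRd R d)) (D : set Omega).

(* Stands for outside N X U: the rest of the argument uses the enumeration X and
   the marks U only through the following properties. *)
Variable away : set (borelRd R d) -> set (set Omega).
Hypothesis away_setT : forall B, away B setT.
Hypothesis away_setI : forall B D D', away B D -> away B D' -> away B (D `&` D').
Hypothesis away_N : forall B C n, measurable C -> away B (count_eq N C n).
Hypothesis away_N1 : forall B C n, measurable B -> measurable C ->
  B `&` C = set0 -> away B (count_eq N1 C n).
Hypothesis away_N2 : forall B C n, measurable B -> bounded_borel C ->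
  B `&` C = set0 -> away B (count_eq N2 C n).
Hypothesis count_N12 : forall w B, bounded_borel B -> exists i j : nat,
  [/\ count_eq N1 B i w, count_eq N2 B j w & count_eq N B (i + j) w].
Hypothesis thinning_N : forall B i j D, bounded_borel B -> away B D ->
  pr P (D `&` count_eq N1 B i `&` count_eq N2 B j) =
  pr P (D `&` count_eq N B (i + j)) * binomial_pmf (i + j) p i.

Lemma count_eq_inj (M : R.-ker Omega ~> borelRd R d) B m n w :
  count_eq M B m w -> count_eq M B n w -> m = n.
Proof. by rewrite /count_eq /= => -> /natr_EFin_inj. Qed.

Lemma count_eq_N12 w B i j : bounded_borel B ->
  count_eq N1 B i w -> count_eq N2 B j w -> count_eq N B (i + j) w.
Proof.
move=> bB Ni Nj; have [i' [j' [Ni' Nj' ]]] := count_N12 w bB.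
by rewrite (count_eq_inj Ni Ni') (count_eq_inj Nj Nj').
Qed.

Lemma count_N w B : bounded_borel B -> exists n, count_eq N B n w.
Proof. by move=> /(count_N12 w)[i [j [_ _ Nij]]]; exists (i + j)%N. Qed.

Lemma pr_partition_count (A D : set Omega) (a b : R) B : bounded_borel B ->
  measurable A -> measurable D ->
  (forall n, a * pr P (A `&` count_eq N B n) = b * pr P (D `&` count_eq N B n)) ->
  a * pr P A = b * pr P D.
Proof.
move=> bB mA mD; apply: pr_partition => //.
- by move=> n; apply: measurable_count_eq; case: bB.
- by move=> i j w; exact: count_eq_inj.
- by move=> w _; exact: count_N.
Qed.

Lemma away_counts B m (C : 'I_m -> set (borelRd R d)) (M : R.-ker Omega ~> borelRd R d)
    (a : 'I_m -> nat) :
  (forall k, away B (count_eq M (C k) (a k))) -> away B (counts_eq M C a).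
Proof.
elim: m C a => [|m IH] C a aC.
  rewrite (_ : counts_eq _ _ _ = setT)//.
  by rewrite -subTset => w _ [].
rewrite (_ : counts_eq _ _ _ =
  counts_eq M (C \o widen_ord (leqnSn m)) (a \o widen_ord (leqnSn m)) `&`
  count_eq M (C ord_max) (a ord_max)).
  by apply: away_setI => //; apply: IH => k; exact: aC.
apply/seteqP; split=> w; first by move=> /ord_recr_forall.
by move=> H; apply/ord_recr_forall.
Qed.

(** Apart from (i + j)!, the binomial weight splits into a function of [i] and a function of [j];
    both directions rest on this splitting. *)
Lemma binomial_pmf_fact i j : binomial_pmf (i + j) p i * (i`!%:R * j`!%:R) =
  (i + j)`!%:R * p ^+ i * (1 - p) ^+ j.
Proof.
have ij : (i <= i + j)%N by exact: leq_addr.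
rewrite -(bin_fact ij) addKn !natrM /binomial_pmf addKn.
by rewrite -mulr_natr /=; ring.
Qed.

(** * From independent thinnings to a Poisson process *)

Section from_independence.
Hypothesis p01 : 0 < p < 1.
Hypothesis N12_independent : independent_processes P N1 N2.

(** For N and [x = 1] this is f_D(n) = n! P(D, N(B) = n). For N1 with [x = p] and N2 with
    [x = 1 - p] it gives x_D(n) and y_D(n): the division cancels the powers in the binomial weight,
    which is possible because [0 < p < 1]. *)
Let weight (x : R) (M : R.-ker Omega ~> borelRd R d) B D n :=
  pr P (D `&` count_eq M B n) * n`!%:R / x ^+ n.

(** Independence of N1 and N2 enters here: it factors the probability of D1, D2, N1(B) = i, N2(B) =
    j, which the thinning formula expresses through N(B) = i + j. *)
Let weight_mul B i j D1 D2 : bounded_borel B ->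
  <<s count_events N1 >> D1 -> <<s count_events N2 >> D2 ->
  away B D1 -> away B D2 ->
  weight p N1 B D1 i * weight (1 - p) N2 B D2 j = weight 1 N B (D1 `&` D2) (i + j).
Proof.
move=> bB s1 s2 a1 a2; have mB := bB.1.
have /andP[p_gt0 p_lt1] := p01.
have q0 : 1 - p != 0 by apply: lt0r_neq0; lra.
have p0 : p != 0 by exact: lt0r_neq0.
have m1 := count_events_measurable s1; have m2 := count_events_measurable s2.
have mN1 := measurable_count_eq N1 i mB; have mN2 := measurable_count_eq N2 j mB.
have : pr P (D1 `&` count_eq N1 B i) * pr P (D2 `&` count_eq N2 B j) =
    pr P (D1 `&` D2 `&` count_eq N B (i + j)) * binomial_pmf (i + j) p i.
  rewrite -thinning_N//; last exact: away_setI.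
  apply: EFin_inj; rewrite EFinM -!prE.
  - rewrite -setIA setIACA; apply/esym/N12_independent.
      by apply: count_events_setI => //; exact: count_events_eq.
    by apply: count_events_setI => //; exact: count_events_eq.
  - by apply: measurableI => //; apply: measurableI => //; exact: measurableI.
  - exact: measurableI.
  - exact: measurableI.
rewrite /weight expr1n divr1 => H.
have -> : forall a b c e f g : R, a * b / c * (e * f / g) = a * e * (b * f) / (c * g).
  by move=> *; rewrite invfM; ring.
rewrite H -(mulrA (pr P _) (binomial_pmf _ _ _)) binomial_pmf_fact.
by field; rewrite !expf_neq0.
Qed.

Let sT (M : R.-ker Omega ~> borelRd R d) : <<s count_events M >> [set: Omega].
Proof. exact: (@measurableT _ (g_sigma_algebraType (count_events M))). Qed.

Lemma pr_count_away B n D1 D2 : bounded_borel B ->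
  <<s count_events N1 >> D1 -> <<s count_events N2 >> D2 ->
  away B D1 -> away B D2 ->
  pr P (D1 `&` D2 `&` count_eq N B n) = pr P (D1 `&` D2) * pr P (count_eq N B n).
Proof.
move=> bB s1 s2 a1 a2.
have m1 := count_events_measurable s1; have m2 := count_events_measurable s2.
(* The inserted total mass 1 turns the claim into an identity that can be summed over the values m
   of N(B). *)
rewrite -[LHS]mulr1 -(pr_setT P) [RHS]mulrC.
apply: (pr_partition_count bB) => //; first exact: measurableI.
move=> m; rewrite setTI.
pose D := D1 `&` D2.
suff : weight 1 N B D n * weight 1 N B setT m = weight 1 N B D m * weight 1 N B setT n.
  rewrite /weight !expr1n !divr1 !setTI => H.
  have nm0 : n`!%:R * m`!%:R != 0 :> R by rewrite mulf_neq0 // pnatr_eq0 -lt0n fact_gt0.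
  by apply: (mulIf nm0); lra.
have X i j : weight p N1 B D1 i * weight (1 - p) N2 B D2 j = weight 1 N B D (i + j).
  exact: weight_mul.
have X0 i j : weight p N1 B setT i * weight (1 - p) N2 B setT j = weight 1 N B setT (i + j).
  by rewrite -[X in weight 1 N B X]setTI; apply: weight_mul.
have X1 i j : weight p N1 B D1 i * weight (1 - p) N2 B setT j = weight 1 N B D1 (i + j).
  by rewrite -[X in weight 1 N B X]setIT; apply: weight_mul.
(* With n read as n + 0 and m as 0 + m, the left side contains the product of x_D1(n) and y(m). By
   [X1] it equals f_D1(n + m), which is symmetric in n and m. *)
rewrite -[n in LHS]addn0 -[m in RHS]addn0 -!X -[m in LHS]add0n -[n in RHS]add0n -!X0.
have := X1 n m; rewrite addnC -X1 => X1nm.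
rewrite mulrACA [RHS]mulrACA mulrA [RHS]mulrA.
have -> : forall a b c e : R, a * b * c * e = a * e * (b * c) by move=> *; ring.
by rewrite X1nm; ring.
Qed.

(** With trivial events, both sides are the product of x(n), x(0), y(m) and y(0), grouped
    differently. *)
Lemma weight_morph B n m : bounded_borel B ->
  pr P (count_eq N B (n + m)) * (n + m)`!%:R * pr P (count_eq N B 0) =
  (pr P (count_eq N B n) * n`!%:R) * (pr P (count_eq N B m) * m`!%:R).
Proof.
move=> bB.
have X0 i j : weight p N1 B setT i * weight (1 - p) N2 B setT j =
    pr P (count_eq N B (i + j)) * (i + j)`!%:R.
  rewrite weight_mul// /weight expr1n divr1 !setTI//.
have := X0 0 0; rewrite addn0 fact0 mulr1 => <-.
rewrite -X0 -[n in RHS]addn0 -[m in RHS]add0n -!X0; ring.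
Qed.

(** The functional equation of [weight_morph] makes f a geometric sequence, and total mass 1 then
    forces f(0) to be exp(-x). *)
Lemma count_poisson B : bounded_borel B ->
  exists2 x : R, 0 <= x & forall n, pr P (count_eq N B n) = poisson_mass x n.
Proof.
move=> bB; pose f n := pr P (count_eq N B n) * n`!%:R.
have fD n m : f (n + m)%N * f 0 = f n * f m.
  by rewrite /f fact0 mulr1 weight_morph.
have fact_neq0 n : n`!%:R != 0 :> R by rewrite pnatr_eq0 -lt0n fact_gt0.
have f_ge0 n : 0 <= f n by rewrite mulr_ge0 ?pr_ge0.
(* If f(0) = 0, then the square of f(n) is f(2n) f(0) = 0 for every n, and the probabilities could
   not sum to 1. *)
have f0 : 0 < f 0.
  rewrite lt_neqAle f_ge0 andbT eq_sym; apply/eqP => f00.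
  have : 1 * pr P setT = 0 * pr P setT :> R.
    apply: (pr_partition_count bB) => // n; rewrite setTI mul0r mul1r.
    have /eqP := fD n n; rewrite f00 mulr0 eq_sym mulf_eq0 orbb /f mulf_eq0.
    by rewrite (negbTE (fact_neq0 n)) orbF => /eqP.
  by rewrite pr_setT; lra.
pose x := f 1 / f 0; exists x; first by rewrite divr_ge0.
have fX n : f n = f 0 * x ^+ n.
  elim: n => [|n IH]; first by rewrite expr0 mulr1.
  have := fD 1%N n; rewrite add1n IH exprS => H.
  apply: (mulIf (lt0r_neq0 f0)); rewrite H /x.
  by field; exact: lt0r_neq0.
have prN n : pr P (count_eq N B n) = f 0 * (x ^+ n / n`!%:R).
  by rewrite mulrA -fX /f mulfK.
have x0 : 0 <= x by rewrite divr_ge0.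
have : (P setT = \sum_(0 <= n <oo) (f 0)%:E * (x ^+ n / n`!%:R)%:E)%E.
  rewrite (_ : setT = \bigcup_n count_eq N B n); last first.
    by apply/seteqP; split=> // w _; have [n] := count_N w bB; exists n.
  rewrite measure_semi_bigcup.
  - apply: eq_eseriesr => n _; rewrite -EFinM -prN; apply: prE.
    by apply: measurable_count_eq; case: bB.
  - by move=> n; apply: measurable_count_eq; case: bB.
  - by move=> i j _ _ [w [Hi Hj]]; exact: count_eq_inj Hi Hj.
  - by apply: bigcup_measurable => n _; apply: measurable_count_eq; case: bB.
rewrite nneseriesZl ?expR_eseries//; last first.
  by move=> n _; rewrite lee_fin divr_ge0// exprn_ge0.
rewrite probability_setT -EFinM => -[f0e] n.
rewrite prN /poisson_mass expRN; congr (_ * _).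
apply: (mulIf (lt0r_neq0 (expR_gt0 x))).
by rewrite -f0e mulVf// gt_eqF// expR_gt0.
Qed.

(** An event about the N(C k) is not of the form D1 and D2 in general. It is cut into cells that fix
    every N1(C k) and N2(C k), where [pr_count_away] applies; summing over the values of N(B) then
    passes to a general [F]. *)
Lemma count_away m (C : 'I_m -> set (borelRd R d)) (E : 'I_m -> set \bar R) B F :
  bounded_borel B -> measurable F -> (forall k, bounded_borel (C k)) ->
  (forall k, measurable (E k)) -> (forall k, B `&` C k = set0) ->
  pr P ([set w | forall k, E k (N w (C k))] `&` N ^~ B @^-1` F) =
  pr P [set w | forall k, E k (N w (C k))] * pr P (N ^~ B @^-1` F).
Proof.
move=> bB mF bC mE BC; have mB := bB.1; have mC k := (bC k).1.
set D := [set w | _].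
have mD : measurable D.
  rewrite (_ : D = \bigcap_k (N ^~ (C k) @^-1` E k)); last first.
    by apply/seteqP; split=> w H k; [move=> _; exact: H|exact: H].
  by apply: fin_bigcap_measurable => // k _; exact: measurable_preimage_kernel.
have DN n : pr P (D `&` count_eq N B n) = pr P D * pr P (count_eq N B n).
  rewrite -[LHS]mul1r [RHS]mulrC.
  pose I := ({ffun 'I_m -> nat} * {ffun 'I_m -> nat})%type.
  pose G (ab : I) := counts_eq N1 C ab.1 `&` counts_eq N2 C ab.2.
  have mN := measurable_count_eq N n mB.
  have mG ab : measurable (G ab).
    by apply: measurableI; apply: count_events_measurable; exact: count_events_eqs.
  apply: (pr_partition (F := G)) => //; first exact: measurableI.
  - move=> [a b] [a' b'] w [/= Ha Hb] [/= Ha' Hb']; congr pair; apply/ffunP => k.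
      exact: count_eq_inj (Ha k) (Ha' k).
    exact: count_eq_inj (Hb k) (Hb' k).
  - move=> w _; have /choice[a] := fun k => count_N12 w (bC k).
    move=> /choice[b Hab]; exists ([ffun k => a k], [ffun k => b k]).
    by split=> k /=; rewrite ffunE; case: (Hab k).
  move=> ab; rewrite mul1r.
  (* On a cell each N(C k) is the constant [ab.1 k + ab.2 k], so the cell lies inside [D] or misses
     it. *)
  have [GD|GD] := pselect (forall k, E k (ab.1 k + ab.2 k)%:R%:E).
    have DG : G ab `<=` D.
      by move=> w [H1 H2] k /=; rewrite (count_eq_N12 (bC k) (H1 k) (H2 k)).
    rewrite (setIidr DG) setIAC (setIidr DG) mulrC pr_count_away//.
    - exact: count_events_eqs.
    - exact: count_events_eqs.
    - by apply: away_counts => k; exact: away_N1.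
    - by apply: away_counts => k; exact: away_N2.
  have DG0 : D `&` G ab = set0.
    rewrite -subset0 => w [Dw [H1 H2]]; apply: GD => k.
    by have := Dw k; rewrite /= (count_eq_N12 (bC k) (H1 k) (H2 k)).
  by rewrite setIAC DG0 set0I pr_set0 mulr0.
have mNF := measurable_preimage_kernel N mB mF.
rewrite -[LHS]mul1r; apply: (pr_partition_count bB) => //; first exact: measurableI.
move=> n; rewrite mul1r -setIA.
have [Fn|Fn] := pselect (F n%:R%:E).
  have NF : count_eq N B n `<=` N ^~ B @^-1` F by move=> w /= ->.
  by rewrite (setIidr NF) DN.
rewrite (_ : _ `&` count_eq N B n = set0) ?setI0 ?pr_set0 ?mulr0//.
by rewrite -subset0 => w [/= + NB]; rewrite NB.
Qed.

Lemma counts_mutually_independent m (C : 'I_m -> set (borelRd R d)) (E : 'I_m -> set \bar R) :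
  (forall k, bounded_borel (C k)) -> (forall k, measurable (E k)) ->
  (forall j k, j != k -> C j `&` C k = set0) ->
  pr P [set w | forall k, E k (N w (C k))] =
  \prod_(k < m) pr P (N ^~ (C k) @^-1` E k).
Proof.
elim: m C E => [|m IH] C E bC mE tC.
  by rewrite big_ord0 -(pr_setT P); congr pr; apply/seteqP; split=> // w _ [].
pose w_ := widen_ord (leqnSn m).
rewrite big_ord_recr /=.
transitivity (pr P ([set w | forall k, E (w_ k) (N w (C (w_ k)))] `&`
    N ^~ (C ord_max) @^-1` E ord_max)).
  congr pr; apply/seteqP; split=> w; first by move=> /ord_recr_forall.
  by move=> H; apply/ord_recr_forall.
have Cmax k : C ord_max `&` (C \o w_) k = set0.
  apply: tC; rewrite eq_sym; apply/eqP => /(congr1 val) /= km.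
  by have := ltn_ord k; rewrite km ltnn.
have bCw k : bounded_borel ((C \o w_) k) by exact: bC.
have mEw k : measurable ((E \o w_) k) by exact: mE.
have -> := count_away (bC ord_max) (mE ord_max) bCw mEw Cmax.
congr (_ * _); apply: (IH (C \o w_) (E \o w_)) => // j k jk.
by apply: tC; apply: contra_neq jk => /(congr1 val) jk; exact: val_inj.
Qed.

End from_independence.

(** Induction on [m]. The thinning formula for the last set treats the thinned counts on the other
    sets as part of the outside event. The event on N that it leaves is absorbed into [D], since
    counts of N are away from every set; hence the general [D]. *)
Lemma pr_thinned_counts m (C : 'I_m -> set (borelRd R d)) (a b : 'I_m -> nat) D :
  (forall k, bounded_borel (C k)) -> (forall j k, j != k -> C j `&` C k = set0) ->
  (forall k, away (C k) D) ->
  pr P (D `&` counts_eq N1 C a `&` counts_eq N2 C b) =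
  pr P (D `&` counts_eq N C (fun k => a k + b k)%N) *
    \prod_(k < m) binomial_pmf (a k + b k) p (a k).
Proof.
have recr M l (C' : 'I_l.+1 -> set (borelRd R d)) (a' : 'I_l.+1 -> nat) :
    counts_eq M C' a' =
    counts_eq M (C' \o widen_ord (leqnSn l)) (a' \o widen_ord (leqnSn l)) `&`
    count_eq M (C' ord_max) (a' ord_max).
  apply/seteqP; split=> w; first by move=> /ord_recr_forall.
  by move=> H; apply/ord_recr_forall.
elim: m C a b D => [|m IH] C a b D bC tC aD.
  rewrite big_ord0 mulr1; congr pr; apply/seteqP; split=> w.
    by move=> [[Dw _] _]; split=> // -[].
  by move=> [Dw _]; split; [split=> // -[]|move=> []].
pose w_ := widen_ord (leqnSn m).
have tCw j k : j != k -> (C \o w_) j `&` (C \o w_) k = set0.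
  by move=> jk; apply: tC; apply: contra_neq jk => /(congr1 val) jk; exact: val_inj.
have Cmax k : C ord_max `&` (C \o w_) k = set0.
  apply: tC; rewrite eq_sym; apply/eqP => /(congr1 val) /= km.
  by have := ltn_ord k; rewrite km ltnn.
have mC k := (bC k).1.
rewrite !recr big_ord_recr /=.
set V := counts_eq N1 (C \o _) _; set W := counts_eq N2 (C \o _) _.
set v := count_eq N1 _ _; set u := count_eq N2 _ _.
rewrite !setIA (setIAC _ v W) thinning_N//; last first.
  apply: away_setI; first apply: away_setI => //.
    by apply: away_counts => k; exact: away_N1 (mC _) (mC (w_ k)) (Cmax k).
  by apply: away_counts => k; exact: away_N2 (mC _) (bC (w_ k)) (Cmax k).
set n := count_eq N _ _.
rewrite (_ : D `&` V `&` W `&` n = D `&` n `&` V `&` W); last first.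
  by rewrite setIAC (setIAC D V n).
have bCw k : bounded_borel ((C \o w_) k) by exact: bC.
have aDn k : away ((C \o w_) k) (D `&` n).
  by apply: away_setI; [exact: (aD (w_ k))|exact: away_N].
rewrite (IH (C \o w_) (a \o w_) (b \o w_) (D `&` n) bCw tCw aDn).
rewrite mulrA; congr (pr P _ * _ * _).
exact: setIAC.
Qed.

(** * From a Poisson process to independent thinnings *)

Section from_poisson.
Hypothesis N_poisson : forall B, bounded_borel B ->
  exists2 x : R, 0 <= x & forall n, pr P (count_eq N B n) = poisson_mass x n.
Hypothesis N_independent : forall m (C : 'I_m -> set (borelRd R d)) (a : 'I_m -> nat),
  (forall k, bounded_borel (C k)) -> (forall j k, j != k -> C j `&` C k = set0) ->
  pr P (counts_eq N C a) = \prod_(k < m) pr P (count_eq N (C k) (a k)).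

(** Product of the Poisson laws of means xp and x(1 - p), with exp(-x) left whole in the first
    factor: only the separation of [i] and [j] matters. *)
Lemma poisson_mass_binomial (x : R) i j :
  poisson_mass x (i + j) * binomial_pmf (i + j) p i =
  (expR (- x) * ((x * p) ^+ i / i`!%:R)) * ((x * (1 - p)) ^+ j / j`!%:R).
Proof.
have fact_neq0 n : n`!%:R != 0 :> R by rewrite pnatr_eq0 -lt0n fact_gt0.
have ij0 : i`!%:R * j`!%:R != 0 :> R by rewrite mulf_neq0.
apply: (mulIf ij0); rewrite -(mulrA (poisson_mass _ _)) binomial_pmf_fact.
rewrite /poisson_mass !exprMn exprD; field.
by rewrite !fact_neq0.
Qed.

(** The joint law has the form g(a) h(b), which gives the exchange identity without normalizing g
    and h. *)
Lemma thinned_counts_exchange m (C : 'I_m -> set (borelRd R d)) (a a' b b' : 'I_m -> nat) :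
  (forall k, bounded_borel (C k)) -> (forall j k, j != k -> C j `&` C k = set0) ->
  pr P (counts_eq N1 C a `&` counts_eq N2 C b) *
    pr P (counts_eq N1 C a' `&` counts_eq N2 C b') =
  pr P (counts_eq N1 C a `&` counts_eq N2 C b') *
    pr P (counts_eq N1 C a' `&` counts_eq N2 C b).
Proof.
move=> bC tC.
have /choice[x Cx] : forall k, exists y, forall n,
    pr P (count_eq N (C k) n) = poisson_mass y n.
  by move=> k; have [y _ Hy] := N_poisson (bC k); exists y.
pose g (a : 'I_m -> nat) :=
  \prod_(k < m) (expR (- x k) * ((x k * p) ^+ a k / (a k)`!%:R)).
pose h (b : 'I_m -> nat) := \prod_(k < m) ((x k * (1 - p)) ^+ b k / (b k)`!%:R).
have gh e f : pr P (counts_eq N1 C e `&` counts_eq N2 C f) = g e * h f.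
  rewrite -[counts_eq N1 C e]setTI pr_thinned_counts// setTI N_independent//.
  rewrite -!big_split /=; apply: eq_bigr => k _.
  by rewrite Cx poisson_mass_binomial.
by rewrite !gh; ring.
Qed.

(** The counts on the given sets are sums of counts on atoms, so [E] is a union of cells of
    N1-counts and [F] one of cells of N2-counts, as [pr_product_partition] requires. *)
Lemma bounded_counts_independent E F : bounded_counts N1 E -> bounded_counts N2 F ->
  pr P (E `&` F) = pr P E * pr P F.
Proof.
move=> GE GF; have mE := bounded_counts_measurable GE.
have mF := bounded_counts_measurable GF.
case: GE => [I [B [e [bB EE]]]]; case: GF => [J [B' [f [bB' FE]]]].
(* Both families are refined together, so that the same disjoint sets serve N1 and N2. *)
have [m [C [Q [bC tC CB]]]] := @bounded_atoms R d (I + J)%type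
  (fun k => match k with inl i => B i | inr j => B' j end)
  (fun k => match k with inl i => bB i | inr j => bB' j end).
have tC' j k : j != k -> C j `&` C k = set0.
  by move=> jk; apply/eqP/negPn; apply: contra_neqN jk => /set0P; exact: tC.
have sumM (M : R.-ker Omega ~> borelRd R d) w (a : 'I_m -> nat) k : counts_eq M C a w ->
    M w (\big[setU/set0]_(l < m | Q k l) C l) = (\sum_(l < m | Q k l) a l)%:R%:E.
  move=> aM; rewrite measure_bigsetU_ord//; last by move=> l; case: (bC l).
  by rewrite natr_sum -sumEFin; apply: eq_bigr => l _; exact: aM.
pose V (a : {ffun 'I_m -> nat}) := counts_eq N1 C a.
pose W (a : {ffun 'I_m -> nat}) := counts_eq N2 C a.
have mC l : measurable (C l) by case: (bC l).
have inj (M : R.-ker Omega ~> borelRd R d) (a a' : {ffun 'I_m -> nat}) w :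
    counts_eq M C a w -> counts_eq M C a' w -> a = a'.
  by move=> aM a'M; apply/ffunP => k; exact: count_eq_inj (aM k) (a'M k).
have ex w : exists a b, V a w /\ W b w.
  have /choice[a] := fun k => count_N12 w (bC k).
  move=> /choice[b Hab]; exists [ffun k => a k], [ffun k => b k].
  by split=> k /=; rewrite ffunE; case: (Hab k).
apply: (pr_product_partition (V := V) (W := W)) => //.
- by move=> a; apply: (@count_events_measurable _ _ _ _ N1); exact: count_events_eqs.
- by move=> a; apply: (@count_events_measurable _ _ _ _ N2); exact: count_events_eqs.
- by move=> a a' w; exact: inj.
- by move=> a a' w; exact: inj.
- by move=> w; have [a [b []]] := ex w; exists a.
- by move=> w; have [a [b []]] := ex w; exists b.
- by move=> a a' b b'; exact: thinned_counts_exchange.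
- move=> a; have [ea|ea] := pselect (forall i, (\sum_(l < m | Q (inl i) l) a l)%N = e i).
    by left=> w Va; rewrite EE => i; rewrite /count_eq /= (CB (inl i)) (sumM _ _ _ _ Va) ea.
  right; rewrite -subset0 EE => w [Ew Va]; apply: ea => i.
  by have := Ew i; rewrite /count_eq /= (CB (inl i)) (sumM _ _ _ _ Va) => /natr_EFin_inj.
- move=> a; have [fa|fa] := pselect (forall j, (\sum_(l < m | Q (inr j) l) a l)%N = f j).
    by left=> w Wa; rewrite FE => j; rewrite /count_eq /= (CB (inr j)) (sumM _ _ _ _ Wa) fa.
  right; rewrite -subset0 FE => w [Fw Wa]; apply: fa => j.
  by have := Fw j; rewrite /count_eq /= (CB (inr j)) (sumM _ _ _ _ Wa) => /natr_EFin_inj.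
Qed.

(** The pi-lambda lemma is applied twice: first in [E] with [F] arbitrary, then in [F] with [E]
    already in the pi-system. *)
Lemma thinned_independent : independent_processes P N1 N2.
Proof.
move=> E F sE sF.
have mE := count_events_measurable sE; have mF := count_events_measurable sF.
rewrite !prE//; last exact: measurableI.
rewrite -EFinM; congr EFin.
have {}sE : <<s bounded_counts N1 >> E.
  apply: count_events_bounded sE => w B /(count_N12 w)[i [j [? _ _]]].
  by exists i.
have {}sF : <<s bounded_counts N2 >> F.
  apply: count_events_bounded sF => w B /(count_N12 w)[i [j [_ ? _]]].
  by exists j.
apply: (pr_independent_g_sigma (@bounded_counts_measurable _ _ _ _ N1)) sE => //.
  exact: bounded_countsI.
move=> {mE}E GE; have mE := bounded_counts_measurable GE.
rewrite setIC [RHS]mulrC.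
apply: (pr_independent_g_sigma (@bounded_counts_measurable _ _ _ _ N2)) sF => //.
  exact: bounded_countsI.
by move=> {mF}F GF; rewrite setIC mulrC; exact: bounded_counts_independent.
Qed.

End from_poisson.
End thinning_pair.

(** * The intensity as a measure, and its value on Poisson counts *)

Section intensity_measure.
Context (R : realType) (d : nat) (dO : measure_display)
  (Omega : measurableType dO) (P : probability Omega R)
  (N : R.-ker Omega ~> borelRd R d).

Let intensity0 : intensity P N set0 = 0%E.
Proof. by rewrite /intensity integral0_eq. Qed.

Let intensity_ge0 B : (0 <= intensity P N B)%E.
Proof. exact: integral_ge0. Qed.

Let intensity_sigma_additive : semi_sigma_additive (intensity P N).
Proof.
move=> F mF tF mUF; rewrite /intensity.
under eq_integral do rewrite measure_semi_bigcup//.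
rewrite integral_nneseries//; last by move=> n; exact: measurable_kernel.
by apply: is_cvg_ereal_nneg_natsum => n _; exact: intensity_ge0.
Qed.

HB.instance Definition _ := isMeasure.Build _ _ _ (intensity P N)
  intensity0 intensity_ge0 intensity_sigma_additive.

Definition intensity_measure : {measure set (borelRd R d) -> \bar R} :=
  intensity P N.

(** Identifies the rate found by [count_poisson] with the intensity: N(B) is the sum over n of n
    times the indicator of N(B) = n, integrated term by term. *)
Lemma poisson_intensity B x : bounded_borel B -> 0 <= x ->
  (forall w, exists n, count_eq N B n w) ->
  (forall n, pr P (count_eq N B n) = poisson_mass x n) ->
  intensity P N B = x%:E.
Proof.
move=> [mB _] x0 NB Nx; rewrite -poisson_mean// /intensity.
have mc n : measurable (count_eq N B n) by exact: measurable_count_eq.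
transitivity (\int[P]_w
    (\sum_(0 <= n <oo) (n%:R%:E * (\1_(count_eq N B n) w)%:E)))%E.
  apply: eq_integral => w _; have [m Nm] := NB w.
  rewrite (nneseriesD1 (n := m) (P := xpredT)) => [|n _|//]; last first.
    by rewrite -EFinM lee_fin mulr_ge0.
  rewrite eseries0 ?adde0; last first.
    move=> n _ /andP[_ nm]; rewrite indicE memNset ?mule0// => Nn.
    by move: nm; rewrite (natr_EFin_inj (etrans (esym Nn) Nm)) eqxx.
  by rewrite indicE mem_set// mule1; exact: Nm.
rewrite integral_nneseries//; last first.
  by move=> n; apply: measurable_funeM; apply/measurable_EFinP; exact: measurable_indic.
apply: eq_eseriesr => n _; rewrite ge0_integralZl_EFin//.
- by rewrite integral_indic// setIT -Nx EFinM -prE.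
- by apply/measurable_EFinP; exact: measurable_indic.
Qed.

End intensity_measure.

(** The converse is stated for [0 < p < 1]: for p equal to 0 or 1 one of the two thinnings is almost
    surely null, and independence holds whatever N is. *)
Theorem theorem1 (R : realType) (d : nat) (dO : measure_display)
    (Omega : measurableType dO) (P : probability Omega R)
    (N N1 N2 : R.-ker Omega ~> borelRd R d) (p : R)
    (N_point_process : point_process N)
    (N_intensity : locally_finite (intensity P N))
    (p01 : 0 <= p <= 1)
    (N1_thinning : thinning P p N N1)
    (N2_complement : forall w B, measurable B -> N w B = (N1 w B + N2 w B)%E) :
  (poisson_process P N -> independent_processes P N1 N2) /\
  (0 < p < 1 -> independent_processes P N1 N2 -> poisson_process P N).
Proof.
have [X [U [NX marksU N1E]]] := N1_thinning.
pose away B := @outside R d dO Omega N X U B.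
have awayT B : away B setT by exact: outside_setT.
have awayI B D D' : away B D -> away B D' -> away B (D `&` D') by exact: outside_setI.
have awayN B C n : measurable C -> away B (count_eq N C n).
  by move=> mC; exact: outside_N mC (emeasurable_set1 n%:R%:E).
have awayN1 B C n : measurable B -> measurable C -> B `&` C = set0 ->
    away B (count_eq N1 C n).
  by move=> mB mC BC; exact (outside_N1 N1E mB mC BC (emeasurable_set1 (n%:R%:E))).
have awayN2 B C n : measurable B -> bounded_borel C -> B `&` C = set0 ->
    away B (count_eq N2 C n).
  move=> mB [mC bC] BC.
  exact (outside_N2 N_point_process NX N1E N2_complement mB mC BC bC
    (emeasurable_set1 (n%:R%:E))).
have N12 w B : bounded_borel B -> exists i j : nat,
    [/\ count_eq N1 B i w, count_eq N2 B j w & count_eq N B (i + j) w].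
  by move=> [mB bB]; apply: (count_N12 N_point_process NX N1E N2_complement).
have thin B i j D : bounded_borel B -> away B D ->
    pr P (D `&` count_eq N1 B i `&` count_eq N2 B j) =
    pr P (D `&` count_eq N B (i + j)) * binomial_pmf (i + j) p i.
  by move=> [mB bB]; apply: (thinning_count NX marksU N1E N2_complement).
split.
  move=> [mu [_ [_ muN indN]]].
  apply: (thinned_independent awayT awayI awayN awayN1 awayN2 N12 thin).
    move=> B [mB bB]; exists (fine (mu B)); first exact: fine_ge0.
    by move=> n; rewrite /pr /count_eq muN// poisson_probE// fine_ge0.
  move=> m C a bC tC.
  have mC k : measurable (C k) by case: (bC k).
  have tC' : trivIset setT C.
    by move=> j k _ _ [x Cx]; apply/eqP/negPn/negP => /tC jk; rewrite jk in Cx.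
  have := indN m C mC (fun k => (bC k).2) tC' (fun k => [set (a k)%:R%:E])
    (fun k => emeasurable_set1 _).
  rewrite -counts_eq_bigcap => H; apply: EFin_inj; rewrite -prodEFin -prE; last first.
    by apply: (@count_events_measurable _ _ _ _ N); exact: count_events_eqs.
  by rewrite H; apply: eq_bigr => k _; apply: prE; exact: measurable_count_eq.
(* A Poisson count has its rate as mean, so the intensity is the only candidate; it is locally
   finite by hypothesis. *)
move=> p_01 ind; exists (intensity_measure P N); split=> //; split=> //.
  move=> B mB bB k; have bbB : bounded_borel B by [].
  have [x x0 Nx] := count_poisson awayT awayI N12 thin p_01 ind bbB.
  have muB : intensity P N B = x%:E.
    apply: poisson_intensity => // w.
    by have [i [j [_ _ ?]]] := N12 w _ bbB; exists (i + j)%N.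
  rewrite [X in fine X]muB /=.
  rewrite poisson_probE// -Nx; apply: prE; exact: measurable_count_eq.
move=> n B mB bB tB E mE.
have tB' j k : j != k -> B j `&` B k = set0.
  by move=> jk; apply/eqP/negPn; apply: contra_neqN jk => /set0P; exact: tB.
have bbB k : bounded_borel (B k) by [].
have := counts_mutually_independent awayT awayI awayN1 awayN2 N12 thin p_01 ind bbB mE tB'.
have mNE k : measurable (N ^~ (B k) @^-1` E k) by exact: measurable_preimage_kernel.
rewrite (_ : mkset _ = \bigcap_k (N ^~ (B k) @^-1` E k)); last first.
  by apply/seteqP; split=> w H k; [move=> _; exact: H|exact: H].
move=> H; rewrite prE; last exact: fin_bigcap_measurable.
by rewrite H -prodEFin; apply: eq_bigr => k _; rewrite prE.
Qed.
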